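(* Let $s=(s_n)_{n\ge 0}$ be a normalized Hamburger moment sequence which is indeterminate as a Hamburger moment sequence and which is a Stieltjes moment sequence. Let $A,C$ be the corresponding Nevanlinna functions, let $\alpha_1<\alpha_2<\alpha_3<\cdots$ be the zeros of $A$ listed in increasing order, and let $\alpha(s)$ be the quantity defined in the context. Then the function $l(x)=C(x)/A(x)$ is strictly decreasing in each of the intervals $(-\infty,\alpha_1), (\alpha_1,\alpha_2), (\alpha_2,\alpha_3),\ldots$, with one-sided limits $$\lim_{x\to\alpha_k^-} l(x)=-\infty,\qquad \lim_{x\to\alpha_k^+} l(x)=\infty,\qquad k=1,2,\ldots.$$ Moreover, $$\alpha(s)=\lim_{x\to -\infty}\frac{C(x)}{A(x)}.$$
   Context: A normalized Hamburger moment sequence is a sequence $s=(s_n)_{n\ge0}$ of real numbers with $s_0=1$ such that the set $V$ of probability measures $\mu$ on $\mathbb{R}$ with moments of every order and $\int x^n\,d\mu(x)=s_n$ for all $n\ge 0$ is non-empty. It is indeterminate (as a Hamburger moment sequence) if $V$ contains more than one measure (then infinitely many). It is a Stieltjes moment sequence if at least one $\mu\in V$ is supported by $[0,\infty)$. $P_n$, $n\ge 0$, are the orthonormal polynomials for (any) $\mu\in V$, with $\deg P_n=n$ and positive leading coefficient. With $a_n=\int xP_n^2(x)\,d\mu(x)\in\mathbb{R}$ and $b_n=\int xP_n(x)P_{n+1}(x)\,d\mu(x)>0$ (for any $\mu\in V$), both $(P_n)$ and the polynomials of the second kind $(Q_n)$ satisfy $$x y_n=b_n y_{n+1}+a_n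 y_n+b_{n-1}y_{n-1},\quad n\ge 1,$$ with initial conditions $P_0(x)=1$, $P_1(x)=(x-a_0)/b_0$, $Q_0(x)=0$, $Q_1(x)=1/b_0$. In the indeterminate case the sequences $(P_n(z))$ and $(Q_n(z))$ are in $\ell^2$ for every $z\in\mathbb{C}$, and the Nevanlinna functions are the entire functions $$A(z)=z\sum_{k=0}^\infty Q_k(z)Q_k(0),\qquad B(z)=-1+z\sum_{k=0}^\infty P_k(z)Q_k(0),$$ $$C(z)=1+z\sum_{k=0}^\infty Q_k(z)P_k(0),\qquad D(z)=z\sum_{k=0}^\infty P_k(z)P_k(0).$$ Each of these has infinitely many zeros, all real and simple. Under the present assumptions (indeterminate and Stieltjes) the zeros of $A$ are bounded below, with smallest zero $\alpha_1=0$, and they form an increasing sequence $\alpha_1<\alpha_2<\cdots$ tending to infinity. For such $s$ the quantity $\alpha(s)$ is defined by $$\alpha(s)=\lim_{x\to-\infty}\frac{D(x)}{B(x)}=\lim_{n\to\infty}\frac{P_n(0)}{Q_n(0)};$$ it is known that both limits exist, coincide and belong to $(-\infty,0]$. *)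

(* Defs.v *)
From HB Require Import structures.
From mathcomp Require Import all_boot all_order all_algebra.
From mathcomp Require Import all_classical all_reals all_analysis.

Set Implicit Arguments.
Unset Strict Implicit.
Unset Printing Implicit Defensive.

Import Order.TTheory GRing.Theory Num.Theory.
Import numFieldNormedType.Exports.

Local Open Scope classical_set_scope.
Local Open Scope ring_scope.

Notation borel_probability R := (probability (measurableTypeR R) R).

Section MomentSequences.
Context {R : realType}.
Implicit Types (s : nat -> R) (mu nu : borel_probability R).

(* The integrability clause matters: [Rintegral] takes the value 0 on some
   non-integrable functions. *)
Definition moment_solution s mu : Prop := forall n : nat,
  mu.-integrable setT (fun x : measurableTypeR R => ((x : R) ^+ n)%:E) /\
  \int[mu]_x ((x : R) ^+ n) = s n.

Definition normalized_hamburger s : Prop :=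
  s 0%N = 1 /\ exists mu, moment_solution s mu.

(* A measure is a function on all subsets of [R], of which only the values on
   Borel sets are relevant. *)
Definition indeterminate s : Prop :=
  exists mu nu, [/\ moment_solution s mu, moment_solution s nu &
    exists2 E : set (measurableTypeR R), measurable E & mu E <> nu E].

Definition stieltjes s : Prop :=
  exists2 mu, moment_solution s mu & mu [set` `]-oo, (0 : R)[] = 0%E.

End MomentSequences.

Section OrthogonalPolynomials.
Context {R : realType}.
Variables (mu : borel_probability R) (P : nat -> {poly R}).

(* These three conditions determine [P] uniquely from the moments of [mu]. *)
Definition orthonormal_polys : Prop :=
  [/\ forall n, size (P n) = n.+1,
      forall n, 0 < lead_coef (P n) &
      forall m n, \int[mu]_x ((P m).[x] * (P n).[x]) = (m == n)%:R].

Definition jacobi_a (n : nat) : R := \int[mu]_x (x * (P n).[x] ^+ 2).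

Definition jacobi_b (n : nat) : R :=
  \int[mu]_x (x * (P n).[x] * (P n.+1).[x]).

(* The three-term recurrence solved for its term of highest index *)
Fixpoint second_kind (n : nat) : {poly R} :=
  match n with
  | 0 => 0
  | n'.+1 =>
    match n' with
    | 0 => ((jacobi_b 0)^-1)%:P
    | m.+1 => (jacobi_b n')^-1 *:
        (('X - (jacobi_a n')%:P) * second_kind n' -
         jacobi_b m *: second_kind m)
    end
  end.

Local Notation Q := second_kind.

(* The Nevanlinna functions are entire; these are their restrictions to the
   real axis. In the indeterminate case they have only real zeros, so that the
   zeros of the restrictions are all their zeros. *)
Definition nevanlinna_A (x : R) : R :=
  x * limn (series (fun k => (Q k).[x] * (Q k).[0])).

Definition nevanlinna_B (x : R) : R :=
  -1 + x * limn (series (fun k => (P k).[x] * (Q k).[0])).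

Definition nevanlinna_C (x : R) : R :=
  1 + x * limn (series (fun k => (Q k).[x] * (P k).[0])).

Definition nevanlinna_D (x : R) : R :=
  x * limn (series (fun k => (P k).[x] * (P k).[0])).

(* For an indeterminate Stieltjes sequence this limit exists and is also the
   limit of [(P n).[0] / (Q n).[0]]. *)
Definition stieltjes_alpha : R :=
  lim ((nevanlinna_D x / nevanlinna_B x) @[x --> -oo]).

End OrthogonalPolynomials.

(* Main.v *)
(* Christoffel-Darboux type identities for the recurrence y |-> J y give
     A(x) C(y) - A(y) C(x) = (x - y) K(x, y)   and   A D - B C = 1,
   with K(x, y) = sum_k Q_k(x) Q_k(y). The first yields (C/A)' = - K(x, x) / A^2 < 0
   off the zeros of A, and C/A ~ C(z)^2 / (K(z, z) (x - z)) at a zero z. For x < 0 a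
   solution on [0, +oo[ makes the signs of P_k(x) and Q_k(x) alternate, so that C >= 1,
   A < 0 and A B -> -oo as x -> -oo. Hence C/A is bounded above by 0 and converges at
   -oo, and D/B = C/A + 1/(A B) has the same limit.

   All this needs (P_k(x)) and (Q_k(x)) in l^2, locally uniformly in x. Two distinct
   solutions nu1, nu2 have distinct Poisson integrals at some point x0 + i/c. Let u, v be
   the differences of the Fourier coefficients, with respect to nu1 and nu2, of
     f(t) = 1 / (1 + (c (t - x0))^2)   and   c (t - x0) f(t).
   They are in l^2 by Bessel's inequality, and c (J - x0) u = v, c (J - x0) v = - u because
   the moments agree. Their Wronskian is therefore sum (u_k^2 + v_k^2) / c, bounded away
   from 0, and a discrete Gronwall argument bounds every solution at a real x by u and v. *)
Require Import Defs.
From HB Require Import structures.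
From mathcomp Require Import all_boot all_order all_algebra.
From mathcomp Require Import all_classical all_reals all_analysis.
From mathcomp Require Import measurable_realfun ring lra.
Import Order.TTheory GRing.Theory Num.Theory.
Import numFieldNormedType.Exports.
Local Open Scope classical_set_scope.
Local Open Scope ring_scope.

(** * Poisson integrals determine a probability measure *)

Section BoundedIntegrals.
Set Implicit Arguments.
Unset Strict Implicit.
Context {R : realType}.
Implicit Types (mu nu : borel_probability R) (f : measurableTypeR R -> R).

Lemma integrable_bounded mu f (M : R) :
  measurable_fun setT f -> (forall t, `|f t| <= M) ->
  mu.-integrable setT (EFin \o f).
Proof.
move=> mf fM; apply: measurable_bounded_integrable => //.
  by apply: le_lt_trans (probability_le1 mu measurableT) _; rewrite ltry.
exists M; split; first exact: num_real.
by move=> M' MM' t _ /=; apply: le_trans (ltW MM').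
Qed.

Lemma bounded_cvg_Rintegral mu (f_ : nat -> measurableTypeR R -> R) f (M : R) :
  (forall n, measurable_fun setT (f_ n)) -> measurable_fun setT f ->
  (forall n t, `|f_ n t| <= M) -> (forall t, f_ n t @[n --> \oo] --> f t) ->
  \int[mu]_t f_ n t @[n --> \oo] --> \int[mu]_t f t.
Proof.
move=> mf_ mf fM fcvg.
have fM' t : `|f t| <= M.
  by apply: (ler_cvg_to (cvg_norm (fcvg t)) (cvg_cst M)); apply: nearW => n.
have iM : mu.-integrable setT (EFin \o (fun _ => M)).
  by apply: (@integrable_bounded mu (fun=> M) `|M|).
have [] := @dominated_convergence _ _ _ mu setT measurableT
  (fun n t => (f_ n t)%:E) (fun t => (f t)%:E) (fun=> M%:E).
- by move=> n; apply/measurable_EFinP.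
- exact/measurable_EFinP.
- apply: aeW => t _; apply: cvg_EFin; last exact: fcvg.
  by apply: nearW.
- exact: iM.
- by apply: aeW => t n _; rewrite lee_fin; exact: fM.
move=> iff _ H; apply: fine_cvg.
by rewrite /Rintegral fineK//; apply: integrable_fin_num.
Qed.

Lemma measurable_atan_affine (a b : R) :
  measurable_fun setT (fun t : measurableTypeR R => atan (a * t + b)).
Proof.
apply: (@measurableT_comp _ _ _ _ _ _ (@atan R)).
  by apply: continuous_measurable_fun; exact: continuous_atan.
apply: measurable_funD => //; exact: measurable_funM.
Qed.

Lemma atan_bounded (x : R) : `|atan x| <= pi / 2.
Proof. by rewrite ler_norml (ltW (atan_ltpi2 x)) (ltW (atan_gtNpi2 x)). Qed.

(** For [c > 0] this is [1 / c] times the imaginary part of [1 / (t - z)] at [z = x + i / c], hence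
    a multiple of the Poisson kernel of the upper half-plane. *)
Definition cauchy_kernel (c x t : R) : R := (1 + (c * (t - x)) ^+ 2)^-1.

Lemma cauchy_kernel_gt0 c x t : 0 < cauchy_kernel c x t.
Proof. by rewrite /cauchy_kernel invr_gt0 ltr_pwDl// sqr_ge0. Qed.

Lemma cauchy_kernel_le1 c x t : cauchy_kernel c x t <= 1.
Proof. by rewrite /cauchy_kernel invf_le1 ?ltr_pwDl ?sqr_ge0// lerDl sqr_ge0. Qed.

Lemma continuous_cauchy_kernel c x : continuous (cauchy_kernel c x).
Proof.
move=> t; apply: cvgV; first by rewrite gt_eqF// ltr_pwDl// sqr_ge0.
apply: cvgD; first exact: cvg_cst.
apply: (@cvg_comp _ _ _ (fun t => c * (t - x)) (fun y => y ^+ 2) _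
   (nbhs (c * (t - x)))); last exact: exprn_continuous.
by apply: cvgM; [exact: cvg_cst | apply: cvgB; [exact: cvg_id|exact: cvg_cst]].
Qed.

Lemma measurable_cauchy_kernel c x :
  measurable_fun setT (cauchy_kernel c x : measurableTypeR R -> R).
Proof. apply: continuous_measurable_fun; exact: continuous_cauchy_kernel. Qed.

(** The [y]-derivative of the integrand is bounded by the constant [|c|], which is integrable for a
    probability measure, so one may differentiate under the integral sign. *)
Lemma is_derive_Rintegral_atan mu (c x : R) :
  is_derive x 1 (fun y => \int[mu]_t atan (c * (t - y)))
    (- c * \int[mu]_t cauchy_kernel c x t).
Proof.
pose f (y t : R) := atan (c * (t - y)).
have df (y t : R) : is_derive y 1 (f ^~ t) (- c * cauchy_kernel c y t).
  have -> : - c * cauchy_kernel c y t = cauchy_kernel c y t * (c * (0 - 1)).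
    by rewrite sub0r mulrN1 mulrC.
  apply: (@is_derive1_comp _ (@atan R) (fun y => c * (t - y))).
have mf (y : R) : measurable_fun setT (f y : measurableTypeR R -> R).
  rewrite (_ : f y = fun t => atan (c * t + - (c * y))); first exact: measurable_atan_affine.
  by apply/funext => t; rewrite /f mulrBr.
have intf (y : R) : mu.-integrable setT (EFin \o f y).
  by apply: (@integrable_bounded _ _ (pi / 2)) => // t; exact: atan_bounded.
have dfE (y t : R) : (partial1of2 f) y t = - c * cauchy_kernel c y t.
  by rewrite partial1of2E; case: (df y t) => _ ->.
have xI : `]x - 1, x + 1[%classic x by rewrite /= in_itv/= ltrBlDr ltrDl ltr01.
have derf (y t : R) : (`]x - 1, x + 1[%classic : set R) y -> (setT : set R) t ->
    derivable (f ^~ t) y 1.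
  by move=> _ _; case: (df y t).
have intG : mu.-integrable setT (EFin \o (fun=> `|c|)).
  by apply: (@integrable_bounded mu (fun=> `|c|) `|c|) => // t; rewrite normr_id.
have Gub (y t : R) : (`]x - 1, x + 1[%classic : set R) y -> (setT : set R) t ->
    `|(partial1of2 f) y t| <= `|c|.
  move=> _ _; rewrite dfE normrM normrN ler_piMr//.
  by rewrite ger0_norm ?(ltW (cauchy_kernel_gt0 _ _ _))// cauchy_kernel_le1.
apply: DeriveDef.
  exact: (@derivable_under_integral R _ _ mu f setT measurableT x _ _ xI
    (fun y _ => intf y) derf _ (fun=> normr_ge0 c) intG Gub).
rewrite -derive1E (@differentiation_under_integral R _ _ mu f setT measurableT x _ _ xI
  (fun y _ => intf y) derf _ (fun=> normr_ge0 c) intG Gub).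
rewrite -RintegralZl//; first by apply: eq_Rintegral => t _; rewrite dfE.
apply: (@integrable_bounded _ _ 1); first exact: measurable_cauchy_kernel.
move=> t; rewrite ger0_norm ?cauchy_kernel_le1//; exact/ltW/cauchy_kernel_gt0.
Qed.

Lemma cvg_atan_pinfty (u : nat -> R) :
  u n @[n --> \oo] --> +oo -> atan (u n) @[n --> \oo] --> pi / 2.
Proof. by move=> uoo; exact: (@cvg_comp _ _ _ u (@atan R) _ _ _ uoo (@cvgy_atan R)). Qed.

Lemma cvg_atan_ninfty (u : nat -> R) :
  u n @[n --> \oo] --> -oo -> atan (u n) @[n --> \oo] --> - (pi / 2).
Proof.
move=> /cvgNry uoo.
under eq_fun do rewrite -[u _]opprK atanN.
by apply: cvgN; apply: cvg_atan_pinfty.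
Qed.

Lemma Rintegral_cst_probability mu (r : R) : \int[mu]_t r = r.
Proof.
rewrite Rintegral_cst// -[RHS]mulr1; congr (_ * _).
exact: (congr1 fine (probability_setT mu)).
Qed.

(** For fixed [c] both sides have the same derivative in [x], so their difference is constant. It
    vanishes because both tend to [pi / 2] as [x] tends to [-oo]. *)
Lemma Rintegral_atan_unique mu nu :
  (forall c x : R, 0 < c ->
    \int[mu]_t cauchy_kernel c x t = \int[nu]_t cauchy_kernel c x t) ->
  forall c x : R, 0 < c ->
    \int[mu]_t atan (c * (t - x)) = \int[nu]_t atan (c * (t - x)).
Proof.
move=> munu c x c0.
pose F mu' (y : R) := \int[mu']_t atan (c * (t - y)).
have Fcst y : F mu x - F nu x = F mu y - F nu y.
  apply: (@is_derive_0_is_cst R (F mu - F nu)) => z.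
  have := is_deriveB (is_derive_Rintegral_atan mu c z) (is_derive_Rintegral_atan nu c z).
  by rewrite (munu _ _ c0) subrr.
have Foo mu' : F mu' (- n%:R) @[n --> \oo] --> pi / 2.
  have -> : pi / 2 = \int[mu']_t (pi / 2).
    by rewrite Rintegral_cst_probability.
  apply: (@bounded_cvg_Rintegral mu' (fun n t => atan (c * (t - (- n%:R)))) _ (pi / 2)) => //.
  - move=> n; rewrite (_ : (fun t => _) = fun t => atan (c * t + c * n%:R)).
      exact: measurable_atan_affine.
    by apply/funext => t; rewrite opprK mulrDr.
  - by move=> n t; exact: atan_bounded.
  - move=> t /=; apply: cvg_atan_pinfty; apply/cvgryPge => A.
    near=> n.
    have : A / c - t <= n%:R by near: n; exact: (cvgry_ge (cvgr_idn (R := R))).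
    by rewrite opprK lerBlDl ler_pdivrMr// mulrC.
apply/eqP; rewrite -subr_eq0; apply/eqP.
have H : F mu (- n%:R) - F nu (- n%:R) @[n --> \oo] --> pi / 2 - pi / 2.
  exact: cvgB.
have H' : F mu (- n%:R) - F nu (- n%:R) @[n --> \oo] --> F mu x - F nu x.
  by under eq_fun do rewrite -Fcst; exact: cvg_cst.
rewrite (cvg_unique _ H' H) ?subrr//; exact: norm_hausdorff.
Unshelve. all: by end_near. Qed.

(** A form of Stieltjes inversion: integrals of ever steeper arctangents converge to an affine
    function of the mass of []x, +oo[], and these half-lines are closed under intersection and
    generate the Borel sets. *)
Lemma measure_cauchy_kernel_unique mu nu :
  (forall c x : R, 0 < c ->
    \int[mu]_t cauchy_kernel c x t = \int[nu]_t cauchy_kernel c x t) ->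
  forall E : set (measurableTypeR R), measurable E -> mu E = nu E.
Proof.
move=> munu.
have atan_munu := Rintegral_atan_unique munu.
(* [atan (n^2 (t - x) - n)] tends to [pi / 2] on ]x, +oo[ and to [- pi / 2] on its
   complement; the shift [- n] settles the case [t = x]. *)
pose J x : set (measurableTypeR R) := `]x, +oo[%classic.
have mJ x : measurable (J x) by exact: measurable_itv.
pose h (x : R) (t : measurableTypeR R) : R := pi * \1_(J x) t - pi / 2.
have mh x : measurable_fun setT (h x).
  apply: measurable_funB => //; apply: measurable_funM => //.
pose g x n (t : measurableTypeR R) : R :=
  atan (n.+1%:R ^+ 2 * (t - (x + n.+1%:R^-1))).
have hg mu' x : \int[mu']_t g x n t @[n --> \oo] --> pi * fine (mu' (J x)) - pi / 2.
  have -> : pi * fine (mu' (J x)) - pi / 2 = \int[mu']_t h x t.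
    rewrite /h RintegralB//=; last 2 first.
      apply: (@integrable_bounded _ _ `|pi|); first exact: measurable_funM.
      move=> t; rewrite normrM ler_piMr// indicE.
      by case: (_ \in _); rewrite ?normr1 ?normr0.
      by apply: (@integrable_bounded _ _ `|pi / 2|).
    rewrite RintegralZl//=; last first.
      apply: (@integrable_bounded _ _ 1) => // t; rewrite indicE.
      by case: (_ \in _); rewrite ?normr1 ?normr0.
    by rewrite Rintegral_cst_probability {1}/Rintegral integral_indic// setIT.
  apply: (@bounded_cvg_Rintegral mu' (g x) _ (pi / 2)) => //.
  - move=> n; rewrite (_ : g x n = fun t =>
        atan (n.+1%:R ^+ 2 * t + - (n.+1%:R ^+ 2 * (x + n.+1%:R^-1)))).
      exact: measurable_atan_affine.
    by apply/funext => t; rewrite /g mulrBr.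
  - by move=> n t; exact: atan_bounded.
  - move=> t.
    have noo (A : R) : \forall n \near \oo, A <= n.+1%:R.
      near=> n; apply: (@le_trans _ _ n%:R); last by rewrite ler_nat.
      by near: n; exact: (cvgry_ge (cvgr_idn (R := R))).
    have gE n : n.+1%:R ^+ 2 * (t - (x + n.+1%:R^-1)) =
        n.+1%:R * (n.+1%:R * (t - x) - 1).
      by field; rewrite addrC natr1 pnatr_eq0.
    rewrite /h indicE mem_setE /J /= in_itv/= andbT /g; under eq_fun do rewrite gE.
    have [xt|tx] := ltP x t.
      rewrite mulr1 (_ : pi - pi / 2 = pi / 2); last lra.
      apply: cvg_atan_pinfty; apply/cvgryPge => A.
      near=> n.
      have nA : `|A| <= n.+1%:R by near: n; exact: noo.
      (* From this index on, [n.+1 * (t - x) - 1] is at least 1, so the argument of [atan] is at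
         least [n.+1]. For [t <= x] the same factor is at most -1. *)
      have nx : 2 / (t - x) <= n.+1%:R by near: n; exact: noo.
      rewrite ler_pdivrMr ?subr_gt0// in nx.
      apply: le_trans (ler_norm A) _; apply: le_trans nA _.
      by rewrite ler_peMr// lerBrDr.
    rewrite mulr0 sub0r.
    apply: cvg_atan_ninfty; apply/cvgrNyPle => A.
    near=> n.
    have nA : - A <= n.+1%:R by near: n; exact: noo.
    have nx : n.+1%:R * (t - x) <= 0 by rewrite mulr_ge0_le0// subr_le0.
    have n0 : (0 : R) <= n.+1%:R by [].
    nra.
have JE x : mu (J x) = nu (J x).
  have H : pi * fine (mu (J x)) - pi / 2 = pi * fine (nu (J x)) - pi / 2.
    apply: (cvg_unique (@norm_hausdorff _ _) (hg mu x)); apply: cvg_trans (hg nu x).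
    by apply: near_eq_cvg; apply: nearW => n; rewrite /g atan_munu// exprn_gt0.
  move/addIr/(mulfI (lt0r_neq0 (pi_gt0 R))) : H => H.
  by rewrite -[LHS]fineK ?fin_num_measure// H fineK// fin_num_measure.
move=> E mE.
apply: (@measure_unique _ R (measurableTypeR R) (@RGenOInfty.G R)
  (fun k => `]- k%:R, +oo[%classic)) => //.
- exact: RGenOInfty.measurableE.
- move=> _ _ [a ->] [b ->]; exists (Num.max a b); apply/seteqP; split => y /=.
    by rewrite !in_itv/= !andbT gt_max => -[-> ->].
  by rewrite !in_itv/= !andbT gt_max => /andP[].
- by move=> i; exists (- i%:R).
- apply/seteqP; split => // y _.
  have [n _ /(_ n (leqnn n))] := cvgry_ge (cvgr_idn (R := R)) (1 - y) => /= ny.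
  by exists n => //=; rewrite in_itv/= andbT ltrNl; lra.
- by move=> _ [a ->]; exact: JE.
- by move=> k; apply: le_lt_trans (probability_le1 mu (mJ _)) _; rewrite ltry.
Unshelve. all: by end_near. Qed.

End BoundedIntegrals.

(** * Integrals of polynomials and Bessel's inequality *)

Section MomentIntegrals.
Set Implicit Arguments.
Unset Strict Implicit.
Context {R : realType}.
Implicit Types (s : nat -> R) (mu nu : borel_probability R).
Implicit Types (f : measurableTypeR R -> R) (p q : {poly R}).

Lemma integrable_horner s mu p : moment_solution s mu ->
  mu.-integrable setT (EFin \o (fun t : measurableTypeR R => p.[t : R])).
Proof.
move=> sol.
apply: (@eq_integrable _ _ _ mu setT measurableT
  (fun t => \sum_(i <- index_enum 'I_(size p)) ((p`_i)%:E * ((t : R) ^+ i)%:E)%E)).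
  by move=> t _ /=; rewrite horner_coef -sumEFin; apply: eq_bigr => i _; rewrite EFinM.
apply: (@integrable_sum _ _ _ mu setT measurableT _ _ xpredT
  (fun (i : 'I_(size p)) (t : measurableTypeR R) => ((p`_i)%:E * ((t : R) ^+ i)%:E)%E)) => i _.
by apply: integrableZl => //; have [] := sol i.
Qed.

(** For bounded measurable [f] this is linear in [p]; at [p = P n] it is the [n]-th Fourier
    coefficient of [f]. *)
Definition pairing mu f p : R := \int[mu]_t (f t * p.[t : R]).

Section Pairing.
Variables (s : nat -> R) (mu : borel_probability R) (f : measurableTypeR R -> R) (M : R).
Hypotheses (sol : moment_solution s mu) (mf : measurable_fun setT f).
Hypothesis fM : forall t, `|f t| <= M.

Lemma integrable_pairing p :
  mu.-integrable setT (EFin \o (fun t => f t * p.[t : R])).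
Proof.
have -> : EFin \o (fun t => f t * p.[t : R]) =
    ((EFin \o f) \* (EFin \o (fun t : measurableTypeR R => p.[t : R])))%E by [].
apply: integrableMr => //; last exact: integrable_horner sol.
by exists M; split; [exact: num_real | move=> x Mx t _; exact: le_trans (fM t) (ltW Mx)].
Qed.

Lemma pairingD p q : pairing mu f (p + q) = pairing mu f p + pairing mu f q.
Proof.
rewrite /pairing -RintegralD//; try exact: integrable_pairing.
by apply: eq_Rintegral => t _; rewrite hornerD mulrDr.
Qed.

Lemma pairingZ c p : pairing mu f (c *: p) = c * pairing mu f p.
Proof.
rewrite /pairing -RintegralZl//; last exact: integrable_pairing.
by apply: eq_Rintegral => t _; rewrite hornerZ mulrCA.
Qed.

Lemma pairing_sum n (c : nat -> R) (F : nat -> {poly R}) :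
  pairing mu f (\sum_(i < n) c i *: F i) = \sum_(i < n) c i * pairing mu f (F i).
Proof.
elim: n => [|n IH]; last by rewrite !big_ord_recr /= pairingD pairingZ IH.
by rewrite !big_ord0 -(scale0r 0) pairingZ mul0r.
Qed.

End Pairing.

Definition moment_integral mu p : R := \int[mu]_t p.[t : R].

Lemma moment_integralE mu p : moment_integral mu p = pairing mu (fun=> 1) p.
Proof. by apply: eq_Rintegral => t _; rewrite mul1r. Qed.

Section Moments.
Variables (s : nat -> R) (mu : borel_probability R).
Hypothesis sol : moment_solution s mu.

Let m1 : measurable_fun setT (fun=> 1 : R) := @measurable_cst _ _ (measurableTypeR R) R setT 1.
Let b1 (t : measurableTypeR R) : `|1 : R| <= 1.
Proof. by rewrite normr1. Qed.

Lemma moment_integralD p q :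
  moment_integral mu (p + q) = moment_integral mu p + moment_integral mu q.
Proof. by rewrite !moment_integralE (pairingD sol m1 b1). Qed.

Lemma moment_integralZ c p : moment_integral mu (c *: p) = c * moment_integral mu p.
Proof. by rewrite !moment_integralE (pairingZ sol m1 b1). Qed.

Lemma moment_integral_sum n (c : nat -> R) (F : nat -> {poly R}) :
  moment_integral mu (\sum_(i < n) c i *: F i) =
  \sum_(i < n) c i * moment_integral mu (F i).
Proof.
rewrite moment_integralE (pairing_sum sol m1 b1).
by apply: eq_bigr => i _; rewrite moment_integralE.
Qed.

Lemma moment_integral_coef p : moment_integral mu p = \sum_(i < size p) p`_i * s i.
Proof.
rewrite -{1}[p]coefK poly_def.
rewrite (moment_integral_sum (size p) (fun i => p`_i) (fun i => 'X^i)).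
apply: eq_bigr => i _; congr (_ * _); rewrite -(sol i).2.
by apply: eq_Rintegral => t _; rewrite hornerXn.
Qed.

(** The integrand [t * p(t)^2] is nonnegative off the null set of negative reals. This is how the
    Stieltjes property enters. *)
Lemma moment_integral_Xsqr_ge0 p :
  mu [set` `]-oo, (0 : R)[] = 0%E -> 0 <= moment_integral mu ('X * p ^+ 2).
Proof.
move=> mu0; rewrite /moment_integral.
pose N : set (measurableTypeR R) := `]-oo, (0 : R)[%classic.
have mN : measurable N by exact: measurable_itv.
have -> : \int[mu]_t ('X * p ^+ 2).[t : R] = \int[mu]_(t in setT `\` N) ('X * p ^+ 2).[t : R].
  congr fine; apply: negligible_integral => //.
  exact: integrable_horner sol.
apply: Rintegral_ge0 => t [_]; rewrite /N /= in_itv/= => /negP; rewrite -leNgt => t0.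
by rewrite hornerM hornerX horner_exp mulr_ge0// sqr_ge0.
Qed.

End Moments.

(** Polynomial integrals are finite combinations of moments. This carries orthonormality and
    positivity from one solution to another. *)
Lemma moment_integral_unique s mu nu p :
  moment_solution s mu -> moment_solution s nu ->
  moment_integral mu p = moment_integral nu p.
Proof. by move=> smu snu; rewrite (moment_integral_coef smu) (moment_integral_coef snu). Qed.

(** With [g] the partial Fourier sum, the integrals of [f g] and of [g^2] both equal the sum of
    squares, so the claim follows by integrating [2 f g - g^2 <= f^2 <= M^2]. *)
Lemma bessel s mu f (M : R) (P : nat -> {poly R}) :
  moment_solution s mu -> measurable_fun setT f -> (forall t, `|f t| <= M) ->
  (forall m n, moment_integral mu (P m * P n) = (m == n)%:R) ->
  forall N, \sum_(n < N) pairing mu f (P n) ^+ 2 <= M ^+ 2.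
Proof.
move=> sol mf fM ortho N.
pose c n := pairing mu f (P n).
pose g := \sum_(n < N) c n *: P n.
have gg : moment_integral mu (g ^+ 2) = \sum_(n < N) c n ^+ 2.
  rewrite expr2 {1}/g mulr_suml.
  under eq_bigr do rewrite -scalerAl.
  rewrite (moment_integral_sum sol N c (fun n => P n * g)).
  apply: eq_bigr => i _; rewrite expr2; congr (_ * _).
  rewrite /g mulr_sumr; under eq_bigr do rewrite -scalerAr.
  rewrite (moment_integral_sum sol N c (fun n => P i * P n)).
  rewrite (bigD1 i)//= ortho eqxx mulr1 big1 ?addr0// => j ji.
  by rewrite ortho (inj_eq val_inj) eq_sym (negbTE ji) mulr0.
have fg : pairing mu f g = \sum_(n < N) c n ^+ 2.
  by rewrite (pairing_sum sol mf fM); apply: eq_bigr => i _; rewrite expr2.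
have ig := integrable_pairing sol mf fM g.
have ig2 := integrable_horner (g ^+ 2) sol.
have -> : \sum_(n < N) pairing mu f (P n) ^+ 2 =
    \int[mu]_t (2 * (f t * g.[t : R]) - (g ^+ 2).[t : R]).
  rewrite RintegralB//; first rewrite RintegralZl//.
    by rewrite -/(pairing mu f g) -/(moment_integral mu (g ^+ 2)) fg gg; rewrite /c; lra.
  rewrite (_ : _ \o _ = fun t => (2%:E * (f t * g.[t : R])%R%:E)%E)//.
  exact: integrableZl.
apply: (@le_trans _ _ (\int[mu]_t (M ^+ 2))).
  apply: le_Rintegral => //.
  - rewrite (_ : _ \o _ = (fun t => (2%:E * (f t * g.[t : R])%R%:E)%E)
       \- (EFin \o (fun t : measurableTypeR R => (g ^+ 2).[t : R])))%E//.
    by apply: integrableB => //; exact: integrableZl.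
  - by apply: (@integrable_bounded _ mu (fun=> M ^+ 2) `|M ^+ 2|).
  - move=> t _; rewrite horner_exp.
    have fM2 : f t ^+ 2 <= M ^+ 2.
      by rewrite -(real_normK (num_real (f t))) lerXn2r// nnegrE// (le_trans _ (fM t)).
    have := sqr_ge0 (f t - g.[t : R]); lra.
by rewrite Rintegral_cst_probability.
Qed.

End MomentIntegrals.

(** * Jacobi matrices: Wronskians and bounds on solutions *)

Section JacobiRecurrence.
Set Implicit Arguments.
Unset Strict Implicit.
Context {R : realType}.
Variables a b : nat -> R.
Implicit Types y w u v : nat -> R.

Definition jacobi_op y (n : nat) : R :=
  b n * y n.+1 + a n * y n + (if n is m.+1 then b m * y m else 0).

Lemma jacobi_opB y w n :
  jacobi_op (fun k => y k - w k) n = jacobi_op y n - jacobi_op w n.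
Proof. by rewrite /jacobi_op; case: n => [|n]; ring. Qed.

Definition wronskian y w (n : nat) : R := b n * (y n.+1 * w n - y n * w n.+1).

(** The discrete Green formula: the diagonal terms cancel and the off-diagonal ones telescope, with
    no boundary term at 0 because row 0 has no subdiagonal entry. *)
Lemma wronskian_sum y w n :
  wronskian y w n =
  \sum_(k < n.+1) (jacobi_op y k * w k - y k * jacobi_op w k).
Proof.
elim: n => [|n IH].
  by rewrite big_ord_recr big_ord0 /wronskian /jacobi_op /=; ring.
by rewrite big_ord_recr /= -IH /wronskian /jacobi_op; ring.
Qed.

(** The Plücker relation for four vectors [(y n, y n.+1)] of the plane. Both Nevanlinna identities
    are limits of it. *)
Lemma wronskian_plucker y1 y2 y3 y4 n :
  wronskian y1 y2 n * wronskian y3 y4 n - wronskian y3 y2 n * wronskian y1 y4 n =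
  wronskian y1 y3 n * wronskian y2 y4 n.
Proof. by rewrite /wronskian; ring. Qed.

(** The Christoffel-Darboux formula. The defect [e] in row 0 treats both kinds at once: it is 0 for
    [P] and 1 for the polynomials of the second kind. *)
Lemma wronskian_eigen x x' e e' y w n :
  (forall k, jacobi_op y k = x * y k + e * (k == 0%N)%:R) ->
  (forall k, jacobi_op w k = x' * w k + e' * (k == 0%N)%:R) ->
  wronskian y w n =
  (x - x') * (\sum_(k < n.+1) y k * w k) + (e * w 0%N - e' * y 0%N).
Proof.
move=> Hy Hw; rewrite wronskian_sum.
elim: n => [|n IH].
  by rewrite !big_ord_recr !big_ord0 /= Hy Hw /=; ring.
by rewrite big_ord_recr [in RHS]big_ord_recr /= IH Hy Hw /=; ring.
Qed.

(* [v + i u] solves the recurrence at the nonreal point [x0 + i / c]. *)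
Section SquareSummable.
Variables (c x0 : R) (u v : nat -> R) (Bu Bv : R).
Hypotheses (c_gt0 : 0 < c) (u0_neq0 : u 0%N != 0).
Hypothesis Ju : forall n, jacobi_op u n = x0 * u n + v n / c.
Hypothesis Jv : forall n, jacobi_op v n = x0 * v n - u n / c.
Hypothesis u_l2 : forall N, \sum_(k < N) u k ^+ 2 <= Bu.
Hypothesis v_l2 : forall N, \sum_(k < N) v k ^+ 2 <= Bv.

Let m k := `|u k| + `|v k|.

Let m_ge0 k : 0 <= m k. Proof. by rewrite addr_ge0. Qed.

Let m_l2 N : \sum_(k < N) m k ^+ 2 <= 2 * (Bu + Bv).
Proof.
apply: (@le_trans _ _ (2 * (\sum_(k < N) u k ^+ 2 + \sum_(k < N) v k ^+ 2))).
  rewrite -big_split mulr_sumr; apply: ler_sum => k _ /=.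
  rewrite -(real_normK (num_real (u k))) -(real_normK (num_real (v k))) /m.
  have := sqr_ge0 (`|u k| - `|v k|); lra.
by rewrite ler_pM2l// lerD.
Qed.

(** Every term of the Green sum equals [(u k ^+ 2 + v k ^+ 2) / c]; the bound keeps only the part
    [u 0 ^+ 2 / c]. *)
Let wronskian_uv n : u 0%N ^+ 2 / c <= wronskian u v n.
Proof.
rewrite wronskian_sum big_ord_recl /= Ju Jv.
rewrite -[leLHS]addr0 lerD//.
  rewrite (_ : _ - _ = (v 0%N ^+ 2 + u 0%N ^+ 2) / c); last by ring.
  by rewrite ler_pM2r ?invr_gt0// lerDr sqr_ge0.
apply: sumr_ge0 => k _; rewrite Ju Jv.
rewrite (_ : _ - _ = (v (bump 0 k) ^+ 2 + u (bump 0 k) ^+ 2) / c); last by ring.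
by rewrite divr_ge0 ?(ltW c_gt0)// addr_ge0 ?sqr_ge0.
Qed.

(** Discrete Gronwall: for [s n] below, expressing [y] through [u] and [v] gives
    [|y n.+1| <= C * s n * m n.+1], hence [s n.+1 <= s n * (1 + C * m n.+1 ^+ 2)]. The product of
    these factors stays bounded because [m] is in l^2, uniformly in [|x| <= r]. *)
Lemma eigen_l2_bound (r : R) : exists B : R, forall x e y,
  `|x| <= r -> `|e| <= 1 -> `|y 0%N| <= 1 ->
  (forall n, jacobi_op y n = x * y n + e * (n == 0%N)%:R) ->
  forall N, \sum_(k < N) y k ^+ 2 <= B.
Proof.
(* [K] dominates both [|x - x0| + 1 / c], the weight of each term of the Green sum, and [m 0], which
   bounds the row 0 defect [e * w 0]. *)
pose K := `|r| + `|x0| + c^-1 + m 0.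
have K0 : 0 <= K by rewrite !addr_ge0// invr_ge0 ltW.
have icE : `|c^-1| = c^-1 by rewrite gtr0_norm ?invr_gt0.
pose w0 := u 0%N ^+ 2 / c.
have w00 : 0 < w0 by rewrite divr_gt0// exprn_even_gt0.
pose C := K / w0.
have C0 : 0 <= C by rewrite divr_ge0 // ltW.
pose S := (1 + m 0) * expR (C * (2 * (Bu + Bv))).
have S0 : 0 <= S by rewrite mulr_ge0 ?expR_ge0 ?addr_ge0.
exists (1 + (C * S) ^+ 2 * (2 * (Bu + Bv))) => x e y xr e1 y01 Jy.
pose s n := 1 + \sum_(k < n.+1) `|y k| * m k.
have s_ge0 n : 0 <= s n by rewrite addr_ge0// sumr_ge0// => k _; rewrite mulr_ge0.
have Wbound (w w' : nat -> R) n : (forall k, `|w k| <= m k) -> (forall k, `|w' k| <= m k) ->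
    (forall k, jacobi_op w k = x0 * w k + w' k / c) -> `|wronskian y w n| <= K * s n.
  move=> wm w'm Jw.
  have -> : wronskian y w n = e * w 0%N + \sum_(k < n.+1) y k * ((x - x0) * w k - w' k / c).
    rewrite wronskian_sum; elim: n => [|n IH].
      by rewrite !big_ord_recr !big_ord0 /= Jy Jw /=; ring.
    by rewrite big_ord_recr [in RHS]big_ord_recr /= IH Jy Jw /=; ring.
  apply: le_trans (ler_normD _ _) _.
  rewrite /s mulrDr mulr1; apply: lerD.
    rewrite normrM; apply: (@le_trans _ _ (1 * m 0)); first exact: ler_pM.
    by rewrite mul1r /K lerDr !addr_ge0// invr_ge0 ltW.
  apply: le_trans (ler_norm_sum _ _ _) _.
  rewrite mulr_sumr; apply: ler_sum => k _.
  rewrite normrM mulrCA ler_wpM2l//.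
  apply: le_trans (ler_normB _ _) _; rewrite !normrM icE.
  apply: (@le_trans _ _ ((`|r| + `|x0|) * m k + m k * c^-1)).
    apply: lerD; last by rewrite ler_pM2r ?invr_gt0.
    apply: ler_pM => //; apply: le_trans (ler_normB _ _) _.
    by rewrite lerD2r (le_trans xr)// ler_norm.
  by rewrite [m k * _]mulrC -mulrDl ler_wpM2r// /K lerDl.
have um k : `|u k| <= m k by rewrite lerDl.
have vm k : `|v k| <= m k by rewrite lerDr.
(* In the plane of pairs (y n, y n.+1), [y] is a combination of [u] and [v] with
   Wronskian coefficients, and these only involve the terms of [y] up to [n]. *)
have ystep n : `|y n.+1| <= C * s n * m n.+1.
  rewrite /C mulrAC -mulrA mulrAC ler_pdivlMr//.
  apply: (@le_trans _ _ (`|y n.+1| * wronskian u v n)).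
    by rewrite ler_wpM2l// wronskian_uv.
  have -> : `|y n.+1| * wronskian u v n = `|y n.+1 * wronskian u v n|.
    by rewrite normrM (ger0_norm (le_trans (ltW w00) (wronskian_uv n))).
  have -> : y n.+1 * wronskian u v n =
     wronskian y v n * u n.+1 - wronskian y u n * v n.+1.
    by rewrite /wronskian; ring.
  apply: le_trans (ler_normB _ _) _.
  have W1 := Wbound u v n um vm Ju.
  have W2 : `|wronskian y v n| <= K * s n.
    (* The recurrence of [v] has the opposite sign, so its companion sequence is [- u]. *)
    apply: (Wbound v (fun k => - u k) n vm) => k; first by rewrite normrN um.
    by rewrite Jv mulNr.
  rewrite [leRHS](_ : _ = K * s n * `|u n.+1| + K * s n * `|v n.+1|); last by rewrite /m; ring.
  by rewrite (normrM (wronskian y v n)) (normrM (wronskian y u n)) lerD// ler_wpM2r.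
have sbound n : s n <= (1 + m 0) * expR (C * \sum_(k < n.+1) m k ^+ 2).
  elim: n => [|n IH].
    rewrite /s !big_ord_recr !big_ord0 /= !add0r.
    apply: (@le_trans _ _ (1 + m 0)).
      by rewrite lerD2l ler_piMl.
    by rewrite ler_peMr ?addr_ge0// -expR0 ler_expR mulr_ge0// sqr_ge0.
  rewrite /s big_ord_recr /= addrA -/(s n).
  apply: (@le_trans _ _ (s n * (1 + C * m n.+1 ^+ 2))).
    rewrite [leRHS]mulrDr mulr1 lerD2l.
    apply: le_trans (ler_wpM2r (m_ge0 _) (ystep n)) _.
    by rewrite le_eqVlt; apply/orP; left; apply/eqP; ring.
  (* The new factor is absorbed by [1 + t <= expR t]. *)
  rewrite [\sum_(k < n.+2) _]big_ord_recr /= [C * (_ + _)]mulrDr expRD [leRHS]mulrA.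
  apply: ler_pM => //; last exact: expR_ge1Dx.
  by rewrite addr_ge0// mulr_ge0// sqr_ge0.
have sS n : s n <= S.
  apply: le_trans (sbound n) _; rewrite ler_wpM2l ?addr_ge0// ler_expR.
  by rewrite ler_wpM2l.
have ybound n : y n.+1 ^+ 2 <= (C * S) ^+ 2 * m n.+1 ^+ 2.
  rewrite -exprMn -(real_normK (num_real (y n.+1))) lerXn2r ?nnegrE//.
    exact: mulr_ge0 (mulr_ge0 C0 S0) (m_ge0 _).
  apply: le_trans (ystep n) _.
  by rewrite ler_wpM2r// ler_wpM2l.
case => [|N].
  have := m_l2 0; rewrite !big_ord0 => B0.
  exact: addr_ge0 ler01 (mulr_ge0 (sqr_ge0 _) B0).
rewrite big_ord_recl /= lerD//.
  by rewrite -(real_normK (num_real (y 0%N))) -[leRHS](expr1n _ 2) lerXn2r ?nnegrE.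
apply: (@le_trans _ _ ((C * S) ^+ 2 * \sum_(k < N) m k.+1 ^+ 2)).
  by rewrite mulr_sumr; apply: ler_sum => k _; exact: ybound.
rewrite ler_wpM2l ?sqr_ge0//; apply: le_trans (m_l2 N.+1).
by rewrite [leRHS]big_ord_recl lerDr sqr_ge0.
Qed.

End SquareSummable.
End JacobiRecurrence.

(** * The three-term recurrence of the orthonormal polynomials *)

Section OrthonormalRecurrence.
Set Implicit Arguments.
Unset Strict Implicit.
Context {R : realType}.
Variables (s : nat -> R) (mu : borel_probability R) (P : nat -> {poly R}).
Hypotheses (sol : moment_solution s mu) (orthoP : orthonormal_polys mu P).
Local Notation a := (jacobi_a mu P).
Local Notation b := (jacobi_b mu P).
Local Notation Q := (second_kind mu P).
Local Notation L := (moment_integral mu).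

Lemma orthonormal_moment m n : L (P m * P n) = (m == n)%:R.
Proof.
have [_ _ /(_ m n) <-] := orthoP.
by apply: eq_Rintegral => t _; rewrite hornerM.
Qed.

Lemma moment_orthonormal_sum n (c : nat -> R) k :
  L ((\sum_(i < n) c i *: P i) * P k) = if (k < n)%N then c k else 0.
Proof.
rewrite mulr_suml; under eq_bigr do rewrite -scalerAl.
rewrite (moment_integral_sum sol n c (fun i => P i * P k)).
under eq_bigr do rewrite orthonormal_moment.
case: ltnP => kn.
  rewrite (bigD1 (Ordinal kn))//= eqxx mulr1 big1 ?addr0// => i.
  by rewrite -(inj_eq val_inj) /= => /negbTE ->; rewrite mulr0.
rewrite big1// => i _.
by rewrite (_ : (i == k :> nat) = false) ?mulr0//; apply: ltn_eqF; exact: leq_trans kn.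
Qed.

(** Some expansion exists by induction on [n], since subtracting a multiple of [P n] removes the
    coefficient of degree [n]; orthonormality then identifies its coefficients. *)
Lemma orthonormal_expand n (p : {poly R}) : (size p <= n)%N ->
  p = \sum_(k < n) L (p * P k) *: P k.
Proof.
move=> sp; suff [c pE] : exists c : nat -> R, p = \sum_(k < n) c k *: P k.
  rewrite [LHS]pE; apply: eq_bigr => k _.
  by rewrite pE moment_orthonormal_sum ltn_ord.
elim: n p sp => [|n IH] p sp.
  by exists (fun=> 0); rewrite big_ord0; apply/eqP; rewrite -size_poly_leq0.
have [sizeP leadP _] := orthoP.
pose d := p`_n / lead_coef (P n).
have [|c qE] := IH (p - d *: P n).
  apply/leq_sizeP => j; rewrite leq_eqVlt => /predU1P[<-|nj].
    rewrite coefB coefZ /d lead_coefE sizeP /= divfK ?subrr//.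
    by have := leadP n; rewrite lead_coefE sizeP => /lt0r_neq0.
  rewrite coefB coefZ !nth_default ?mulr0 ?subr0// ?sizeP//.
  exact: leq_trans sp nj.
exists (fun k => if k == n then d else c k).
rewrite big_ord_recr /= eqxx; apply/eqP; rewrite -subr_eq qE; apply/eqP.
by apply: eq_bigr => k _; rewrite ltn_eqF.
Qed.

Lemma moment_lower_degree (p : {poly R}) n : (size p <= n)%N -> L (p * P n) = 0.
Proof.
move=> sp; rewrite (orthonormal_expand sp).
by rewrite (moment_orthonormal_sum n (fun k => L (p * P k))) ltnn.
Qed.

Lemma jacobi_aE n : a n = L ('X * P n * P n).
Proof. by apply: eq_Rintegral => t _; rewrite !hornerM hornerX expr2 mulrA. Qed.

Lemma jacobi_bE n : b n = L ('X * P n * P n.+1).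
Proof. by apply: eq_Rintegral => t _; rewrite !hornerM hornerX. Qed.

(** In the expansion of ['X * P n], the coefficient at [P k] is also the integral of
    [('X * P k) * P n], which vanishes for [k.+1 < n] by degree. *)
Lemma orthonormal_recurrence n :
  'X * P n = b n *: P n.+1 + a n *: P n + (if n is m.+1 then b m *: P m else 0).
Proof.
have [sizeP _ _] := orthoP.
have szX m : size ('X * P m) = m.+2.
  by rewrite size_mul ?polyX_eq0 -?size_poly_eq0 ?sizeP// size_polyX.
have /orthonormal_expand -> : (size ('X * P n)%R <= n.+2)%N by rewrite szX.
rewrite !big_ord_recr /= -jacobi_aE -jacobi_bE.
suff -> : \sum_(k < n) L ('X * P n * P k) *: P k =
    if n is m.+1 then b m *: P m else 0 by rewrite -addrA addrC [a n *: _ + _]addrC.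
case: n => [|n]; first by rewrite big_ord0.
rewrite big_ord_recr /= big1 ?add0r => [|k _].
  by congr (_ *: _); rewrite jacobi_bE mulrAC.
by rewrite mulrAC moment_lower_degree ?scale0r// szX !ltnS.
Qed.

(** Comparing coefficients of degree [n.+1] in the recurrence shows [b n] to be a quotient of two
    positive leading coefficients. *)
Lemma jacobi_b_gt0 n : 0 < b n.
Proof.
have [sizeP leadP _] := orthoP.
have := congr1 (fun p : {poly R} => p`_n.+1) (orthonormal_recurrence n).
rewrite coefXM /= !coefD !coefZ (nth_default _ (_ : (size (P n) <= n.+1)%N)) ?sizeP//.
have t0 (t : {poly R}) : t = (if n is m.+1 then b m *: P m else 0) -> t`_n.+1 = 0.
  by case: n => [|n] ->; rewrite ?coef0// coefZ nth_default ?mulr0// sizeP.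
rewrite (t0 _ erefl) mulr0 !addr0 => H.
have := leadP n; rewrite lead_coefE sizeP /= H pmulr_lgt0//.
by have := leadP n.+1; rewrite lead_coefE sizeP.
Qed.

Lemma orthonormal0 : P 0%N = 1.
Proof.
have [sizeP leadP _] := orthoP.
have /eqP/size_poly1P[c c0 PE] := sizeP 0%N.
have := leadP 0%N; rewrite PE lead_coefC => c_gt0.
have := orthonormal_moment 0 0; rewrite eqxx PE -polyCM.
rewrite /moment_integral; under eq_Rintegral do rewrite hornerC.
rewrite Rintegral_cst_probability -expr2 => /eqP; rewrite sqrf_eq1 => /orP[/eqP->//|/eqP cN].
by move: c_gt0; rewrite cN ltr0N1.
Qed.

Lemma jacobi_op_first_kind x n :
  jacobi_op a b (fun k => (P k).[x]) n = x * (P n).[x] + 0 * (n == 0%N)%:R.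
Proof.
have := congr1 (fun p : {poly R} => p.[x]) (orthonormal_recurrence n).
rewrite hornerM hornerX mul0r addr0 => ->; rewrite /jacobi_op.
by case: n => [|n]; rewrite !hornerD !hornerZ ?horner0.
Qed.

Lemma jacobi_op_second_kind x n :
  jacobi_op a b (fun k => (Q k).[x]) n = x * (Q n).[x] + 1 * (n == 0%N)%:R.
Proof.
rewrite /jacobi_op; case: n => [|n].
  rewrite [Q 1]/= [Q 0]/= hornerC horner0 divff ?lt0r_neq0 ?jacobi_b_gt0//.
  by rewrite eqxx !mulr0 !addr0 add0r mulr1.
have -> : Q n.+2 = (b n.+1)^-1 *: (('X - (a n.+1)%:P) * Q n.+1 - b n *: Q n) by [].
rewrite hornerZ mulrA divff ?lt0r_neq0 ?jacobi_b_gt0//.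
rewrite hornerD hornerN hornerM hornerZ hornerXsubC.
by have -> : (n.+1 == 0%N) = false by []; rewrite mulr0; ring.
Qed.

(** The Jacobi matrix represents multiplication by the variable, here for coefficients taken against
    any solution [nu]. *)
Lemma jacobi_op_pairing nu (f : measurableTypeR R -> R) (M : R) n :
  moment_solution s nu ->
  measurable_fun setT f -> (forall t, `|f t| <= M) ->
  jacobi_op a b (fun k => pairing nu f (P k)) n = pairing nu f ('X * P n).
Proof.
move=> snu mf fM; rewrite orthonormal_recurrence /jacobi_op.
rewrite !(pairingD snu mf fM) !(pairingZ snu mf fM); congr (_ + _).
case: n => [|n]; last by rewrite (pairingZ snu mf fM).
by rewrite -(scale0r (0 : {poly R})) (pairingZ snu mf fM) mul0r.
Qed.
(** The conjugate Poisson kernel: for [c > 0], the real part matching [cauchy_kernel], so that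
    together they form [1 / (c * (t - z))] with [z = x0 + i / c]. *)
Definition conjugate_kernel (c x0 t : R) : R := c * (t - x0) * cauchy_kernel c x0 t.

Lemma measurable_conjugate_kernel c x0 :
  measurable_fun setT (conjugate_kernel c x0 : measurableTypeR R -> R).
Proof.
apply: measurable_funM; last exact: measurable_cauchy_kernel.
by apply: measurable_funM => //; apply: measurable_funB.
Qed.

Lemma conjugate_kernel_bounded c x0 t : `|conjugate_kernel c x0 t| <= 1.
Proof.
rewrite /conjugate_kernel /cauchy_kernel; set y := c * (t - x0).
rewrite normrM normfV [X in _ / X]ger0_norm ?addr_ge0 ?sqr_ge0//.
rewrite ler_pdivrMr ?ltr_pwDl ?sqr_ge0// mul1r -(real_normK (num_real y)).
have := sqr_ge0 (`|y| - 1); have := normr_ge0 y; nra.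
Qed.

Lemma cauchy_kernel_bounded c x0 (t : R) : `|cauchy_kernel c x0 t| <= 1.
Proof. by rewrite ger0_norm ?cauchy_kernel_le1//; exact/ltW/cauchy_kernel_gt0. Qed.

(** * Differences of Fourier coefficients for two solutions *)

Section TwoSolutions.
Variables (nu1 nu2 : borel_probability R) (c x0 : R).
Hypotheses (sol1 : moment_solution s nu1) (sol2 : moment_solution s nu2).
Hypothesis c_gt0 : 0 < c.

Let mK := measurable_cauchy_kernel c x0.
Let bK := cauchy_kernel_bounded c x0.
Let mH := measurable_conjugate_kernel c x0.
Let bH := conjugate_kernel_bounded c x0.

Definition pairing_gap (f : measurableTypeR R -> R) (n : nat) : R :=
  pairing nu1 f (P n) - pairing nu2 f (P n).

Lemma jacobi_op_gap_kernel n :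
  jacobi_op a b (pairing_gap (cauchy_kernel c x0)) n =
  x0 * pairing_gap (cauchy_kernel c x0) n +
  pairing_gap (conjugate_kernel c x0) n / c.
Proof.
have H nu : moment_solution s nu ->
    jacobi_op a b (fun k => pairing nu (cauchy_kernel c x0) (P k)) n =
    x0 * pairing nu (cauchy_kernel c x0) (P n) +
    c^-1 * pairing nu (conjugate_kernel c x0) (P n).
  move=> snu; rewrite (jacobi_op_pairing _ snu mK bK).
  have -> : pairing nu (conjugate_kernel c x0) (P n) =
      pairing nu (cauchy_kernel c x0) (c *: ('X * P n) + (- c * x0) *: P n).
    apply: eq_Rintegral => t _.
    by rewrite hornerD !hornerZ hornerM hornerX /conjugate_kernel; ring.
  rewrite (pairingD snu mK bK) !(pairingZ snu mK bK).
  by field; rewrite gt_eqF.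
by rewrite /pairing_gap jacobi_opB !H//; ring.
Qed.

(** Writing [f] and [h] for the Poisson and conjugate kernels, [c (t - x0) h = 1 - f]. The constant
    1 contributes the integral of [P n], which is the same for both solutions and cancels in the
    difference. *)
Lemma jacobi_op_gap_conjugate n :
  jacobi_op a b (pairing_gap (conjugate_kernel c x0)) n =
  x0 * pairing_gap (conjugate_kernel c x0) n -
  pairing_gap (cauchy_kernel c x0) n / c.
Proof.
have H nu : moment_solution s nu ->
    jacobi_op a b (fun k => pairing nu (conjugate_kernel c x0) (P k)) n =
    x0 * pairing nu (conjugate_kernel c x0) (P n) +
    (moment_integral mu (P n) - pairing nu (cauchy_kernel c x0) (P n)) / c.
  move=> snu; rewrite (jacobi_op_pairing _ snu mH bH).
  rewrite (moment_integral_unique _ sol snu).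
  have -> : moment_integral nu (P n) =
      pairing nu (conjugate_kernel c x0) (c *: ('X * P n) + (- c * x0) *: P n)
      + pairing nu (cauchy_kernel c x0) (P n).
    rewrite /pairing -RintegralD//.
    - apply: eq_Rintegral => t _.
      rewrite hornerD !hornerZ hornerM hornerX /conjugate_kernel /cauchy_kernel.
      by field; rewrite gt_eqF// ltr_pwDl// sqr_ge0.
    - exact: (integrable_pairing snu mH bH).
    - exact: (integrable_pairing snu mK bK).
  rewrite (pairingD snu mH bH) !(pairingZ snu mH bH).
  by field; rewrite gt_eqF.
by rewrite /pairing_gap jacobi_opB !H//; ring.
Qed.

Lemma pairing_gap_l2 (f : measurableTypeR R -> R) N :
  measurable_fun setT f -> (forall t, `|f t| <= 1) ->
  \sum_(k < N) pairing_gap f k ^+ 2 <= 4.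
Proof.
move=> mf f1.
have H nu : moment_solution s nu -> \sum_(k < N) pairing nu f (P k) ^+ 2 <= 1.
  move=> snu; rewrite -[leRHS](expr1n _ 2); apply: (bessel snu) => // m n.
  by rewrite -(moment_integral_unique _ sol snu) orthonormal_moment.
apply: (@le_trans _ _ (2 * (\sum_(k < N) pairing nu1 f (P k) ^+ 2) +
    2 * (\sum_(k < N) pairing nu2 f (P k) ^+ 2))).
  rewrite !mulr_sumr -big_split; apply: ler_sum => k _ /=; rewrite /pairing_gap.
  have := sqr_ge0 (pairing nu1 f (P k) + pairing nu2 f (P k)); lra.
have := H _ sol1; have := H _ sol2; lra.
Qed.

End TwoSolutions.

(** Here indeterminacy is turned into l^2 bounds: two distinct solutions supply the sequences [u]
    and [v], and the resulting bound is uniform on [|x| <= r]. *)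
Lemma first_second_kind_l2 (r : R) : indeterminate s -> exists B : R,
  forall x, `|x| <= r -> forall N,
    \sum_(k < N) (P k).[x] ^+ 2 <= B /\ \sum_(k < N) (Q k).[x] ^+ 2 <= B.
Proof.
move=> [nu1 [nu2 [sol1 sol2 [E mE nuE]]]].
have [c [x0 [c0 gap0]]] : exists c x0, 0 < c /\
    pairing_gap nu1 nu2 (cauchy_kernel c x0) 0 != 0.
  (* As [P 0 = 1], the gap at index 0 is the difference of the Poisson integrals; were it always 0,
     the two measures would coincide. *)
  apply: contrapT => H; apply: nuE.
  apply: measure_cauchy_kernel_unique mE => c x0 c0.
  apply/eqP; rewrite -subr_eq0; apply: contrapT => /negP gap0; apply: H.
  exists c, x0; split=> //; apply: contra_neq gap0 => <-.
  rewrite /pairing_gap orthonormal0; congr (_ - _);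
    by apply: eq_Rintegral => t _; rewrite hornerC mulr1.
have [B HB] := eigen_l2_bound c0 gap0
  (jacobi_op_gap_kernel x0 sol1 sol2 c0) (jacobi_op_gap_conjugate x0 sol1 sol2 c0)
  (fun N => pairing_gap_l2 sol1 sol2 N (measurable_cauchy_kernel c x0)
    (cauchy_kernel_bounded c x0))
  (fun N => pairing_gap_l2 sol1 sol2 N (measurable_conjugate_kernel c x0)
    (conjugate_kernel_bounded c x0)) r.
exists B => x xr N; split.
  apply: (HB x 0 (fun k => (P k).[x])) => //; rewrite ?normr0//.
    by rewrite orthonormal0 hornerC normr1.
  exact: jacobi_op_first_kind.
apply: (HB x 1 (fun k => (Q k).[x])) => //; rewrite ?normr1//.
  by rewrite [Q 0]/= horner0 normr0.
exact: jacobi_op_second_kind.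
Qed.


End OrthonormalRecurrence.

(** * Series of products of square-summable sequences *)

Section SquareSummableSeries.
Set Implicit Arguments.
Unset Strict Implicit.
Context {R : realType}.
Implicit Types y w c : nat -> R.

Definition square_summable y : Prop :=
  exists B : R, forall N, \sum_(k < N) y k ^+ 2 <= B.

Lemma square_summable_cvg y : square_summable y -> cvgn (series (fun k => y k ^+ 2)).
Proof.
move=> [B yB]; apply: nondecreasing_is_cvgn.
  by apply: nondecreasing_series => n _ _; exact: sqr_ge0.
by exists B => _ [N _ <-]; rewrite /series /= big_mkord.
Qed.

Lemma square_summable_cvg_mul y w : square_summable y -> square_summable w ->
  cvgn (series (fun k => y k * w k)).
Proof.
move=> /square_summable_cvg cy /square_summable_cvg cw; apply: normed_cvg.
have cyw : cvgn (series (fun k => y k ^+ 2 + w k ^+ 2)).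
  have -> : series (fun k => y k ^+ 2 + w k ^+ 2) =
      series (fun k => y k ^+ 2) + series (fun k => w k ^+ 2).
    by apply/funext => n; rewrite /series /= fctE big_split.
  exact: is_cvgD.
apply: (@series_le_cvg _ _ (fun k => y k ^+ 2 + w k ^+ 2)) => // k.
- exact: normr_ge0.
- by rewrite addr_ge0 ?sqr_ge0.
rewrite /= normrM -(real_normK (num_real (y k))) -(real_normK (num_real (w k))).
have := sqr_ge0 (`|y k| - `|w k|); have := mulr_ge0 (normr_ge0 (y k)) (normr_ge0 (w k)).
lra.
Qed.

(** [N] is chosen from the tail of [c] and the common bound [B] alone, which makes the estimate
    uniform on [D]. *)
Lemma square_summable_tail (y : R -> nat -> R) (D : set R) (B : R) c (e : R) :
  (forall x, D x -> forall N, \sum_(k < N) y x k ^+ 2 <= B) ->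
  square_summable c -> 0 < e ->
  exists N, forall x, D x ->
    `|limn (series (fun k => y x k * c k)) - series (fun k => y x k * c k) N| <= e.
Proof.
move=> yB c2 e0.
(* The weight gives [d * |B| <= e]; a tail of [c^2] below [d * e] then makes each half of the
   weighted AM-GM bound at most [e / 2]. *)
pose d := e / (`|B| + 1).
have B1 : 0 < `|B| + 1 by rewrite ltr_wpDl.
have d0 : 0 < d by rewrite divr_gt0.
have cc := square_summable_cvg c2.
have [N _ HN] : \forall N \near \oo,
    limn (series (fun k => c k ^+ 2)) - series (fun k => c k ^+ 2) N <= d * e.
  have : series (fun k => c k ^+ 2) N @[N --> \oo] --> limn (series (fun k => c k ^+ 2)) by [].
  move/cvgrPdist_le => /(_ (d * e)) /(_ (mulr_gt0 d0 e0)).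
  by apply: filterS => N; exact: le_trans (ler_norm _).
exists N => x Dx.
have cy : series (fun k => y x k * c k) M @[M --> \oo] --> limn (series (fun k => y x k * c k)).
  by apply: square_summable_cvg_mul => //; exists B; exact: yB.
apply: (@ler_cvg_to _ \oo _ R (fun M =>
    `|series (fun k => y x k * c k) M - series (fun k => y x k * c k) N|)
   (fun=> e) _ e _ (cvg_cst e)).
  by apply: cvg_norm; apply: cvgB => //; exact: cvg_cst.
near=> M.
have NM : (N <= M)%N by near: M; exact: nbhs_infty_ge.
rewrite sub_series_geq//.
apply: le_trans (ler_norm_sum _ _ _) _.
(* AM-GM: [2 |y c| <= d y^2 + c^2 / d] *)
apply: (@le_trans _ _ (d * (\sum_(N <= k < M) y x k ^+ 2) / 2 +
    (\sum_(N <= k < M) c k ^+ 2) / d / 2)).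
  rewrite mulr_sumr !mulr_suml -big_split /=; apply: ler_sum => k _.
  rewrite normrM -(real_normK (num_real (y x k))) -(real_normK (num_real (c k))).
  have -> : d * `|y x k| ^+ 2 / 2 + `|c k| ^+ 2 / d / 2 =
    `|y x k| * `|c k| + (d * `|y x k| - `|c k|) ^+ 2 / d / 2 by field; rewrite gt_eqF.
  by rewrite lerDl !divr_ge0 ?sqr_ge0// ltW.
have yS : \sum_(N <= k < M) y x k ^+ 2 <= `|B|.
  apply: le_trans (_ : _ <= \sum_(k < M) y x k ^+ 2) _; last first.
    by apply: le_trans (yB _ Dx _) (ler_norm _).
  rewrite -(big_mkord xpredT (fun k => y x k ^+ 2)) (@big_cat_nat _ _ _ N 0 M)//=.
  by rewrite lerDr sumr_ge0// => k _; exact: sqr_ge0.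
have cS : \sum_(N <= k < M) c k ^+ 2 <= d * e.
  rewrite -sub_series_geq//; apply: le_trans (HN N (leqnn _)).
  rewrite lerD2r; apply: nondecreasing_cvgn_le => //.
  by apply: nondecreasing_series => n _ _; exact: sqr_ge0.
have h1 : d * (\sum_(N <= k < M) y x k ^+ 2) <= e.
  apply: le_trans (ler_wpM2l (ltW d0) yS) _.
  by rewrite /d mulrAC ler_pdivrMr// ler_wpM2l ?ltW// ltrDl.
have h2 : (\sum_(N <= k < M) c k ^+ 2) / d <= e by rewrite ler_pdivrMr// mulrC.
lra.
Unshelve. all: by end_near. Qed.

Lemma continuous_square_summable (F : nat -> R -> R) c :
  (forall k, continuous (F k)) -> square_summable c ->
  (forall r, exists B : R, forall x, `|x| <= r -> forall N, \sum_(k < N) F k x ^+ 2 <= B) ->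
  continuous (fun x => limn (series (fun k => F k x * c k))).
Proof.
move=> cF c2 FB x0.
have [B HB] := FB (`|x0| + 1).
apply/cvgrPdist_le => e e0.
have e3 : 0 < e / 3 by rewrite divr_gt0.
have [N HN] := @square_summable_tail (fun x k => F k x)
  [set x | `|x| <= `|x0| + 1] B c (e / 3) HB c2 e3.
have cN : (fun x => series (fun k => F k x * c k) N) x @[x --> x0] -->
    series (fun k => F k x0 * c k) N.
  rewrite /series /=; elim: (N) => [|n IH].
    by under eq_fun do rewrite big_geq//; rewrite big_geq//; exact: cvg_cst.
  rewrite big_nat_recr//=; under eq_fun do rewrite big_nat_recr//=.
  by apply: cvgD => //; apply: cvgM; [exact: cF | exact: cvg_cst].
near=> x.
have xr : `|x| <= `|x0| + 1.
  have : `|x0 - x| < 1 by near: x; apply: cvgr_dist_lt => //; exact: cvg_id.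
  rewrite -[x in `|x| <= _](subrK x0) => H; apply: le_trans (ler_normD _ _) _.
  by rewrite addrC lerD2l distrC ltW.
have h1 := HN x xr.
have h0 : `|x0| <= `|x0| + 1 by rewrite lerDl.
have {}h0 := HN x0 h0.
have h2 : `|series (fun k => F k x0 * c k) N - series (fun k => F k x * c k) N| <= e / 3.
  by near: x; move/cvgrPdist_le : cN; exact.
rewrite (_ : _ - _ =
  (limn (series (fun k => F k x0 * c k)) - series (fun k => F k x0 * c k) N)
  + (series (fun k => F k x0 * c k) N - series (fun k => F k x * c k) N)
  - (limn (series (fun k => F k x * c k)) - series (fun k => F k x * c k) N)); last by ring.
apply: le_trans (ler_normB _ _) _; apply: le_trans (lerD (ler_normD _ _) (lexx _)) _.
lra.
Unshelve. all: by end_near. Qed.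

End SquareSummableSeries.

(** * Continuity of the Nevanlinna functions *)

Section Nevanlinna.
Set Implicit Arguments.
Unset Strict Implicit.
Context {R : realType}.
Variables (s : nat -> R) (mu : borel_probability R) (P : nat -> {poly R}).
Hypotheses (sol : moment_solution s mu) (orthoP : orthonormal_polys mu P).
Hypothesis indet : indeterminate s.
Local Notation a := (jacobi_a mu P).
Local Notation b := (jacobi_b mu P).
Local Notation Q := (second_kind mu P).
Local Notation A := (nevanlinna_A mu P).
Local Notation B := (nevanlinna_B mu P).
Local Notation C := (nevanlinna_C mu P).
Local Notation D := (nevanlinna_D P).

Lemma first_kind_l2 x : square_summable (fun k => (P k).[x]).
Proof.
have [M HM] := first_second_kind_l2 sol orthoP `|x| indet.
by exists M => N; have [] := HM x (lexx _) N.
Qed.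

Lemma second_kind_l2 x : square_summable (fun k => (Q k).[x]).
Proof.
have [M HM] := first_second_kind_l2 sol orthoP `|x| indet.
by exists M => N; have [] := HM x (lexx _) N.
Qed.

Lemma continuous_second_kind_series c : square_summable c ->
  continuous (fun x => limn (series (fun k => (Q k).[x] * c k))).
Proof.
move=> c2; apply: continuous_square_summable => // [k|r].
  exact: continuous_horner.
have [M HM] := first_second_kind_l2 sol orthoP r indet.
by exists M => x xr N; have [] := HM x xr N.
Qed.

Definition second_kind_kernel (x y : R) : R :=
  limn (series (fun k => (Q k).[x] * (Q k).[y])).
Local Notation K := second_kind_kernel.

Lemma continuous_second_kind_kernel y : continuous (K ^~ y).
Proof. exact: continuous_second_kind_series (second_kind_l2 y). Qed.

Let continuous_idM_series c : square_summable c ->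
  continuous (fun x : R => x * limn (series (fun k => (Q k).[x] * c k))).
Proof.
move=> c2 x; apply: (@cvgM _ _ (nbhs x) _ id); first exact: cvg_id.
exact: continuous_second_kind_series.
Qed.

Lemma continuous_nevanlinna_A : continuous A.
Proof. exact: continuous_idM_series (second_kind_l2 0). Qed.

Lemma continuous_nevanlinna_C : continuous C.
Proof.
rewrite /nevanlinna_C => x; apply: cvgD; first exact: cvg_cst.
exact: continuous_idM_series (first_kind_l2 0) x.
Qed.

(** * Wronskian limits and the Nevanlinna identities *)

Lemma cvg_wronskian x x' e e' y w :
  square_summable y -> square_summable w ->
  (forall k, jacobi_op a b y k = x * y k + e * (k == 0%N)%:R) ->
  (forall k, jacobi_op a b w k = x' * w k + e' * (k == 0%N)%:R) ->
  wronskian b y w n @[n --> \oo] -->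
  (x - x') * limn (series (fun k => y k * w k)) + (e * w 0%N - e' * y 0%N).
Proof.
move=> y2 w2 Hy Hw.
under eq_fun do rewrite (wronskian_eigen _ Hy Hw).
apply: cvgD; last exact: cvg_cst.
apply: cvgM; first exact: cvg_cst.
under eq_fun do rewrite -(big_mkord xpredT (fun k => y k * w k)).
have := square_summable_cvg_mul y2 w2.
(* The Wronskian at [n] sums [n.+1] terms, hence the shifted series. *)
by rewrite -(cvg_shiftS (series (fun k => y k * w k))).
Qed.

Let cvgQQ x y : wronskian b (fun k => (Q k).[x]) (fun k => (Q k).[y]) n @[n --> \oo]
  --> (x - y) * K x y.
Proof.
have := cvg_wronskian (second_kind_l2 x) (second_kind_l2 y)
  (jacobi_op_second_kind sol orthoP x) (jacobi_op_second_kind sol orthoP y).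
by rewrite [Q 0]/= !horner0 !mulr0 subrr addr0.
Qed.

Let cvgQP x y : wronskian b (fun k => (Q k).[x]) (fun k => (P k).[y]) n @[n --> \oo]
  --> (x - y) * limn (series (fun k => (Q k).[x] * (P k).[y])) + 1.
Proof.
have := cvg_wronskian (second_kind_l2 x) (first_kind_l2 y)
  (jacobi_op_second_kind sol orthoP x) (jacobi_op_first_kind sol orthoP y).
by rewrite [Q 0]/= (orthonormal0 orthoP) hornerC horner0 mul0r mulr1 subr0.
Qed.

Let cvgPQ x y : wronskian b (fun k => (P k).[x]) (fun k => (Q k).[y]) n @[n --> \oo]
  --> (x - y) * limn (series (fun k => (P k).[x] * (Q k).[y])) - 1.
Proof.
have := cvg_wronskian (first_kind_l2 x) (second_kind_l2 y)
  (jacobi_op_first_kind sol orthoP x) (jacobi_op_second_kind sol orthoP y).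
by rewrite (orthonormal0 orthoP) mul0r mul1r sub0r hornerC.
Qed.

Let cvgPP x y : wronskian b (fun k => (P k).[x]) (fun k => (P k).[y]) n @[n --> \oo]
  --> (x - y) * limn (series (fun k => (P k).[x] * (P k).[y])).
Proof.
have := cvg_wronskian (first_kind_l2 x) (first_kind_l2 y)
  (jacobi_op_first_kind sol orthoP x) (jacobi_op_first_kind sol orthoP y).
by rewrite !mul0r subrr addr0.
Qed.

(** The four Nevanlinna functions are limits of Wronskians of a solution at [x] with one at 0. The
    constants -1 in [B] and 1 in [C] come from the row 0 defect of the second kind. *)
Let cvgA x : wronskian b (fun k => (Q k).[x]) (fun k => (Q k).[0]) n @[n --> \oo] --> A x.
Proof. by have := @cvgQQ x 0; rewrite subr0. Qed.

Let cvgB' x : wronskian b (fun k => (P k).[x]) (fun k => (Q k).[0]) n @[n --> \oo] --> B x.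
Proof. by have := @cvgPQ x 0; rewrite subr0 addrC. Qed.

Let cvgC x : wronskian b (fun k => (Q k).[x]) (fun k => (P k).[0]) n @[n --> \oo] --> C x.
Proof. by have := @cvgQP x 0; rewrite subr0 addrC. Qed.

Let cvgD' x : wronskian b (fun k => (P k).[x]) (fun k => (P k).[0]) n @[n --> \oo] --> D x.
Proof. by have := @cvgPP x 0; rewrite subr0. Qed.

Let cvgQP1 x : wronskian b (fun k => (Q k).[x]) (fun k => (P k).[x]) n @[n --> \oo] --> (1 : R).
Proof. by have := @cvgQP x x; rewrite subrr mul0r add0r. Qed.

(** The limit of the Plücker relation for [Q] at [x], 0, [y] and [P] at 0; the remaining factor, the
    Wronskian of [Q] and [P] at 0, tends to 1. *)
Lemma nevanlinna_AC x y : A x * C y - A y * C x = (x - y) * K x y.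
Proof.
apply: (cvg_unique (@norm_hausdorff _ _) (F := (fun n =>
    wronskian b (fun k => (Q k).[x]) (fun k => (Q k).[y]) n *
    wronskian b (fun k => (Q k).[0]) (fun k => (P k).[0]) n) @ \oo)).
  by rewrite /=; under eq_fun do rewrite -wronskian_plucker; apply: cvgB; apply: cvgM.
by rewrite /= -[(x - y) * _]mulr1; apply: cvgM.
Qed.

Lemma nevanlinna_det x : A x * D x - B x * C x = 1.
Proof.
apply: (cvg_unique (@norm_hausdorff _ _) (F := (fun n =>
    wronskian b (fun k => (Q k).[x]) (fun k => (P k).[x]) n *
    wronskian b (fun k => (Q k).[0]) (fun k => (P k).[0]) n) @ \oo)).
  by rewrite /=; under eq_fun do rewrite -wronskian_plucker; apply: cvgB; apply: cvgM.
have := cvgM (@cvgQP1 x) (@cvgQP1 0); rewrite mulr1; exact.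
Qed.

Lemma second_kind_kernel_gt0 x : 0 < K x x.
Proof.
have Q1 : 0 < (Q 1).[x] ^+ 2.
  by rewrite [Q 1]/= hornerC exprn_gt0// invr_gt0 (jacobi_b_gt0 sol orthoP).
apply: lt_le_trans Q1 _.
have cK := square_summable_cvg_mul (second_kind_l2 x) (second_kind_l2 x).
apply: le_trans (nondecreasing_cvgn_le _ cK 2); last first.
  by apply: nondecreasing_series => n _ _; rewrite -expr2 sqr_ge0.
by rewrite /series /= big_nat_recr//= lerDr sumr_ge0// => k _; rewrite -expr2 sqr_ge0.
Qed.

(* The quadratic form of the truncated Jacobi matrix at an eigenvector of the
   infinite one: only the last row leaves a boundary term. *)
Lemma moment_Xsqr_eigen x e (y : nat -> R) n :
  (forall k, jacobi_op a b y k = x * y k + e * (k == 0%N)%:R) ->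
  moment_integral mu ('X * (\sum_(k < n.+1) y k *: P k) ^+ 2) =
  x * (\sum_(k < n.+1) y k ^+ 2) + e * y 0%N - b n * y n * y n.+1.
Proof.
move=> Hy; set F := \sum_(k < n.+1) _.
have LPF k : moment_integral mu (P k * F) = if (k < n.+1)%N then y k else 0.
  by rewrite mulrC (moment_orthonormal_sum sol orthoP).
have LXPF k : (k < n.+1)%N ->
    moment_integral mu ('X * P k * F) =
    jacobi_op a b y k - (k == n)%:R * (b n * y n.+1).
  move=> kn; rewrite (orthonormal_recurrence sol orthoP) !mulrDl -!scalerAl.
  rewrite !(moment_integralD sol) !(moment_integralZ sol) !LPF kn /jacobi_op.
  have -> : moment_integral mu ((if k is m.+1 then b m *: P m else 0) * F) =
      (if k is m.+1 then b m * y m else 0).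
    case: k kn => [|k] kn.
      by rewrite mul0r -(scale0r (0 : {poly R})) (moment_integralZ sol) mul0r.
    by rewrite -scalerAl (moment_integralZ sol) LPF (ltn_trans _ kn).
  move: kn; rewrite ltnS leq_eqVlt => /predU1P[->|kn].
    rewrite eqxx ltnn mulr1n mulr0 add0r mul1r -(addrA (b n * _)).
    by rewrite [RHS]addrAC subrr add0r.
  by rewrite ltnS kn (ltn_eqF kn) mul0r subr0.
have -> : 'X * F ^+ 2 = \sum_(k < n.+1) y k *: ('X * P k * F).
  have XF : 'X * F = \sum_(k < n.+1) y k *: ('X * P k).
    by rewrite /F mulr_sumr; apply: eq_bigr => k _; rewrite -scalerAr.
  by rewrite expr2 mulrA XF mulr_suml; apply: eq_bigr => k _; rewrite -scalerAl.
rewrite (moment_integral_sum sol _ _ (fun k => 'X * P k * F)).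
under eq_bigr => k _ do rewrite LXPF// Hy.
rewrite mulr_sumr.
have -> : \sum_(k < n.+1) y k * (x * y k + e * (k == 0%N :> nat)%:R -
      (k == n :> nat)%:R * (b n * y n.+1)) =
   \sum_(k < n.+1) x * y k ^+ 2 + \sum_(k < n.+1) (e * y k * (k == 0%N :> nat)%:R)
   - \sum_(k < n.+1) (b n * y k * y n.+1 * (k == n :> nat)%:R).
  rewrite -big_split -sumrB; apply: eq_bigr => k _ /=; ring.
congr (_ + _ - _).
  by rewrite big_ord_recl /= mulr1 big1 ?addr0// => k _; rewrite mulr0.
rewrite big_ord_recr /= eqxx mulr1 big1 ?add0r// => k _.
by rewrite ltn_eqF ?mulr0.
Qed.

(** * Signs and growth on the negative axis *)

Hypothesis stielt : stieltjes s.

(** Positivity of the integral of [t F(t)^2] gives [x * S - b n * y n * y n.+1 >= 0] with [S > 0]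
    the sum of squares, and [x * S] is negative. The condition [e * y 0 = 0] holds for both
    kinds. *)
Lemma eigen_consecutive_lt0 x e (y : nat -> R) n : x < 0 -> e * y 0%N = 0 ->
  (forall k, jacobi_op a b y k = x * y k + e * (k == 0%N)%:R) ->
  y n != 0 -> y n * y n.+1 < 0.
Proof.
move=> x0 ey0 Hy yn0; have [nu snu nu0] := stielt.
have := moment_integral_Xsqr_ge0 snu (\sum_(k < n.+1) y k *: P k) nu0.
rewrite -(moment_integral_unique _ sol snu) (moment_Xsqr_eigen n Hy) ey0 addr0.
have Sy : 0 < \sum_(k < n.+1) y k ^+ 2.
  rewrite big_ord_recr /= ltr_wpDl ?exprn_even_gt0//.
  by rewrite sumr_ge0// => k _; exact: sqr_ge0.
have xS : x * (\sum_(k < n.+1) y k ^+ 2) < 0 by rewrite nmulr_rlt0.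
have := jacobi_b_gt0 sol orthoP n; rewrite -mulrA => b0 H.
have : b n * (y n * y n.+1) < 0 by lra.
by rewrite pmulr_rlt0.
Qed.

Lemma first_kind_sign_lt0 x n : x < 0 -> 0 < (-1) ^+ n * (P n).[x].
Proof.
move=> x0; elim: n => [|n IH].
  by rewrite expr0 mul1r (orthonormal0 orthoP) hornerC.
have Pn0 : (P n).[x] != 0 by apply: contraTN IH => /eqP->; rewrite mulr0 ltxx.
have := @eigen_consecutive_lt0 x 0 (fun k => (P k).[x]) n x0 (mul0r _)
  (jacobi_op_first_kind sol orthoP x) Pn0.
have e1 : ((-1) ^+ n : R) ^+ 2 = 1 by rewrite sqrr_sign.
rewrite exprS; set u := (-1) ^+ n in IH e1 *; move: IH e1; nra.
Qed.

Lemma second_kind_sign_lt0 x n : x < 0 -> 0 < (-1) ^+ n * (Q n.+1).[x].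
Proof.
move=> x0; elim: n => [|n IH].
  by rewrite expr0 mul1r [Q 1]/= hornerC invr_gt0 (jacobi_b_gt0 sol orthoP).
have Qn0 : (Q n.+1).[x] != 0 by apply: contraTN IH => /eqP->; rewrite mulr0 ltxx.
have := @eigen_consecutive_lt0 x 1 (fun k => (Q k).[x]) n.+1 x0 _
  (jacobi_op_second_kind sol orthoP x) Qn0.
rewrite [Q 0]/= horner0 mulr0 => /(_ erefl).
have e1 : ((-1) ^+ n : R) ^+ 2 = 1 by rewrite sqrr_sign.
rewrite exprS; set u := (-1) ^+ n in IH e1 *; move: IH e1.
set q1 := (Q n.+1).[x]; set q2 := (Q n.+2).[x]; nra.
Qed.

Let horner_sign_at0 (p : {poly R}) (u : R) :
  (forall x, x < 0 -> 0 < u * p.[x]) -> 0 <= u * p.[0].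
Proof.
move=> H.
have cp : u * p.[x] @[x --> 0^'-] --> u * p.[0].
  apply: cvgM; first exact: cvg_cst.
  by apply: cvg_at_left_filter; exact: continuous_horner.
apply: (ler_cvg_to (cvg_cst 0) cp).
near=> x; apply/ltW/H; near: x; exact: nbhs_left_lt.
Unshelve. all: by end_near. Qed.

Lemma first_kind_sign_at0 n : 0 <= (-1) ^+ n * (P n).[0].
Proof. by apply: horner_sign_at0 => x; exact: first_kind_sign_lt0. Qed.

Lemma second_kind_sign_at0 n : 0 <= (-1) ^+ n * (Q n.+1).[0].
Proof. by apply: horner_sign_at0 => x; exact: second_kind_sign_lt0. Qed.

Let mul_sign_ge0 (v w : R) n : 0 <= (-1) ^+ n * v -> 0 <= (-1) ^+ n * w -> 0 <= v * w.
Proof.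
move=> h1 h2; have := mulr_ge0 h1 h2.
by rewrite mulrACA -expr2 sqrr_sign mul1r.
Qed.

(** All terms of the series are nonnegative, so it is at least its [k = 1] term [(b 0)^-1 ^+ 2];
    multiplication by [x < 0] reverses the inequality. *)
Lemma nevanlinna_A_le x : x < 0 -> A x <= x * (b 0)^-1 ^+ 2.
Proof.
move=> x0; rewrite /nevanlinna_A ler_nM2l//.
have cv := square_summable_cvg_mul (second_kind_l2 x) (second_kind_l2 0).
have pos k : 0 <= (Q k).[x] * (Q k).[0].
  case: k => [|k]; first by rewrite [Q 0]/= horner0 mul0r.
  by apply: (@mul_sign_ge0 _ _ k); [exact/ltW/second_kind_sign_lt0 | exact: second_kind_sign_at0].
apply: le_trans (nondecreasing_cvgn_le _ cv 2); last by apply: nondecreasing_series.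
by rewrite /series /= !big_nat_recr//= big_geq// horner0 mul0r !add0r !hornerC expr2.
Qed.

Lemma nevanlinna_C_ge1 x : x < 0 -> 1 <= C x.
Proof.
move=> x0; rewrite /nevanlinna_C lerDl; apply: mulr_le0; first exact: ltW.
have cv := square_summable_cvg_mul (second_kind_l2 x) (first_kind_l2 0).
have neg k : (Q k).[x] * (P k).[0] <= 0.
  case: k => [|k]; first by rewrite [Q 0]/= horner0 mul0r.
  rewrite -oppr_ge0 -mulrN; apply: (@mul_sign_ge0 _ _ k).
    exact/ltW/second_kind_sign_lt0.
  by have := first_kind_sign_at0 k.+1; rewrite exprS mulN1r mulNr -mulrN.
apply: le_trans (nonincreasing_cvgn_ge _ cv 0) _; last by rewrite /series /= big_geq.
by apply/nonincreasing_seqP => n; rewrite /series /= big_nat_recr//= gerDl.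
Qed.

(** The terms are nonpositive here; keeping [k = 1] gives a lower bound of quadratic growth. *)
Lemma nevanlinna_B_ge x : x < 0 -> - 1 + x * (x - a 0) * (b 0)^-1 ^+ 2 <= B x.
Proof.
move=> x0; rewrite /nevanlinna_B lerD2l -mulrA ler_nM2l//.
have cv := square_summable_cvg_mul (first_kind_l2 x) (second_kind_l2 0).
have neg k : (P k).[x] * (Q k).[0] <= 0.
  case: k => [|k]; first by rewrite [Q 0]/= horner0 mulr0.
  rewrite -oppr_ge0 -mulNr; apply: (@mul_sign_ge0 _ _ k); last exact: second_kind_sign_at0.
  by have := first_kind_sign_lt0 k.+1 x0; rewrite exprS mulN1r mulNr -mulrN => /ltW.
apply: le_trans (nonincreasing_cvgn_ge _ cv 2) _.
  by apply/nonincreasing_seqP => n; rewrite /series /= big_nat_recr//= gerDl.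
rewrite /series /= !big_nat_recr//= big_geq// horner0 mulr0 !add0r hornerC.
have := jacobi_op_first_kind sol orthoP x 0.
rewrite /jacobi_op (orthonormal0 orthoP) hornerC mul0r !addr0 !mulr1 => P1.
have b0 : b 0 != 0 by rewrite lt0r_neq0// (jacobi_b_gt0 sol orthoP).
have -> : (P 1).[x] = (x - a 0) / b 0 by rewrite -{2}P1 addrK mulrC mulKf.
by rewrite -mulrA expr2.
Qed.

(** * Monotonicity and limits of [C / A] *)

Local Notation l := (fun x : R => C x / A x).

(** By [nevanlinna_AC] the difference quotient is exactly [- K (h + x) x / (A (h + x) * A x)], so
    its limit follows from the continuity of [A] and [K ^~ x]. *)
Lemma is_derive_C_div_A x : A x != 0 -> is_derive x 1 l (- K x x / A x ^+ 2).
Proof.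
move=> Ax0.
have cvg_addx : h + x @[h --> 0^'] --> x.
  rewrite -[X in _ --> X]add0r; apply: cvgD; last exact: cvg_cst.
  exact: cvg_within_filter (@cvg_id _ _).
have lim : h^-1 *: (l (h + x) - l x) @[h --> 0^'] --> - K x x / A x ^+ 2.
  have cA : A (h + x) @[h --> 0^'] --> A x.
    apply: (@cvg_comp _ _ _ (fun h => h + x) A _ (nbhs x)).
      exact: cvg_addx.
    exact: continuous_nevanlinna_A.
  have cK : K (h + x) x @[h --> 0^'] --> K x x.
    apply: (@cvg_comp _ _ _ (fun h => h + x) (K ^~ x) _ (nbhs x)).
      exact: cvg_addx.
    exact: continuous_second_kind_kernel.
  have c1 : - K (h + x) x / (A (h + x) * A x) @[h --> 0^'] --> - K x x / A x ^+ 2.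
    apply: cvgM; first exact: cvgN.
    apply: cvgV; first by rewrite expf_neq0.
    by rewrite expr2; apply: cvgM => //; exact: cvg_cst.
  apply: cvg_trans c1; apply: near_eq_cvg.
  near=> h.
  have h0 : h != 0 by near: h; exact: nbhs_dnbhs_neq.
  have Ah0 : A (h + x) != 0.
    near: h; move/cvgr_neq0 : cA; exact.
  have := nevanlinna_AC (h + x) x; rewrite addrK => H.
  have -> : h^-1 *: (C (h + x) / A (h + x) - C x / A x) =
      - (h^-1 * (A (h + x) * C x - A x * C (h + x)) / (A (h + x) * A x)).
    by rewrite /GRing.scale /=; field; rewrite Ax0 Ah0 h0.
  by rewrite H; field; rewrite Ax0 Ah0 h0.
apply: DeriveDef.
  by apply/cvg_ex; exists (- K x x / A x ^+ 2); under eq_fun do rewrite scaler1.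
rewrite /derive; apply: cvg_lim => //; by under eq_fun do rewrite scaler1.
Unshelve. all: by end_near. Qed.

Lemma C_div_A_decreasing x y : x < y -> (forall z, x <= z <= y -> A z != 0) -> l y < l x.
Proof.
move=> xy Az.
have [z||z] := @MVT R l (fun z => - K z z / A z ^+ 2) x y xy.
- by rewrite in_itv/= => /andP[xz zy]; apply: is_derive_C_div_A; rewrite Az// !ltW.
- apply: derivable_within_continuous => z; rewrite in_itv/= => zxy.
  by have [] := is_derive_C_div_A (Az z zxy).
rewrite in_itv/= => /andP[xz zy] H.
rewrite -subr_lt0 H nmulr_rlt0 ?subr_gt0//.
rewrite mulNr oppr_lt0 divr_gt0 ?second_kind_kernel_gt0//.
by rewrite exprn_even_gt0// Az// !ltW.
Qed.

Lemma nevanlinna_A_lt0 x : x < 0 -> A x < 0.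
Proof.
move=> x0; apply: le_lt_trans (nevanlinna_A_le x0) _.
by rewrite nmulr_rlt0// exprn_gt0// invr_gt0 (jacobi_b_gt0 sol orthoP).
Qed.

Section SingularLimits.
Variable z : R.
Hypothesis Az : A z = 0.

(** Near a zero [z] of [A] one has [l x = g x / (x - z)], and [g z = C z ^+ 2 / K z z] is positive:
    [l] has a simple pole with positive residue. *)
Let g (x : R) : R := C x * C z / K x z.
Let g0 := g z.

Let g0_gt0 : 0 < g0.
Proof.
rewrite /g0 /g divr_gt0 ?second_kind_kernel_gt0// -expr2 exprn_even_gt0//=.
(* [A] and [C] have no common zero, since [A D - B C = 1]. *)
apply/eqP => Cz; have := nevanlinna_det z.
by rewrite Az Cz mul0r mulr0 subrr => /esym/eqP; rewrite oner_eq0.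
Qed.

Let cvg_g : g x @[x --> z] --> g0.
Proof.
apply: cvgM; first by apply: cvgM; [exact: continuous_nevanlinna_C | exact: cvg_cst].
apply: cvgV; first by rewrite gt_eqF// second_kind_kernel_gt0.
exact: continuous_second_kind_kernel.
Qed.

Let C_div_AE x : x != z -> 0 < K x z -> l x = g x / (x - z).
Proof.
move=> xz Kxz; rewrite /= /g.
have := nevanlinna_AC x z; rewrite Az mul0r subr0 => H.
have xz0 : x - z != 0 by rewrite subr_eq0.
have : A x * C z != 0 by rewrite H mulf_neq0// gt_eqF.
rewrite mulf_eq0 negb_or => /andP[Ax Cz].
have -> : K x z = A x * C z / (x - z) by rewrite H mulrAC divff ?mul1r.
by field; rewrite xz0 Ax Cz.
Qed.

Let near_g : \forall x \near z, g0 / 2 < g x.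
Proof. by apply: cvgr_gt cvg_g _ _; rewrite ltr_pdivrMr// ltr_pMr// ltr1n. Qed.

Let near_K : \forall x \near z, 0 < K x z.
Proof. exact: cvgr_gt (@continuous_second_kind_kernel z z) _ (second_kind_kernel_gt0 z). Qed.

Lemma C_div_A_at_right : l x @[x --> z^'+] --> +oo.
Proof.
apply/cvgryPge => M.
have M1 : 0 < `|M| + 1 by rewrite ltr_wpDl.
(* Within this distance to the right of [z], [g x > g0 / 2] makes [g x / (x - z)] exceed
   [|M| + 1]. *)
have d0 : 0 < g0 / 2 / (`|M| + 1) by rewrite divr_gt0// divr_gt0// g0_gt0.
near=> x.
have zx : z < x by near: x; exact: nbhs_right_gt.
have xM : x < z + g0 / 2 / (`|M| + 1).
  by near: x; apply: nbhs_right_lt; rewrite ltrDl.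
have gx : g0 / 2 < g x by near: x; apply: cvg_within; exact: near_g.
have Kx : 0 < K x z by near: x; apply: cvg_within; exact: near_K.
rewrite C_div_AE ?gt_eqF// ler_pdivlMr ?subr_gt0//.
rewrite -ltrBlDl ltr_pdivlMr// in xM.
have := ler_norm M; have : 0 < x - z by rewrite subr_gt0.
move: xM gx; nra.
Unshelve. all: by end_near. Qed.

Lemma C_div_A_at_left : l x @[x --> z^'-] --> -oo.
Proof.
apply/cvgrNyPle => M.
have M1 : 0 < `|M| + 1 by rewrite ltr_wpDl.
have d0 : 0 < g0 / 2 / (`|M| + 1) by rewrite divr_gt0// divr_gt0// g0_gt0.
near=> x.
have xz : x < z by near: x; exact: nbhs_left_lt.
have xM : z - g0 / 2 / (`|M| + 1) < x.
  by near: x; apply: nbhs_left_gt; rewrite ltrBlDr ltrDl.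
have gx : g0 / 2 < g x by near: x; apply: cvg_within; exact: near_g.
have Kx : 0 < K x z by near: x; apply: cvg_within; exact: near_K.
rewrite C_div_AE ?lt_eqF// ler_ndivrMr ?subr_lt0//.
rewrite ltrBlDr -ltrBlDl ltr_pdivlMr// in xM.
have := ler_norm (- M); rewrite normrN; have : 0 < z - x by rewrite subr_gt0.
move: xM gx; nra.
Unshelve. all: by end_near. Qed.

End SingularLimits.

Lemma nevanlinna_B_near_ninfty : \forall x \near -oo, 1 <= B x.
Proof.
have b0 := jacobi_b_gt0 sol orthoP 0.
near=> x.
have x1 : x <= -1 by near: x; apply: nbhs_ninfty_le; exact: num_real.
(* Together with [x <= -1] this gives [x * (x - a 0) >= 2 * b 0 ^+ 2], so the lower bound for [B x]
   is at least [-1 + 2]. *)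
have xa : x <= a 0 - 2 * b 0 ^+ 2 by near: x; apply: nbhs_ninfty_le; exact: num_real.
have x0 : x < 0 by apply: le_lt_trans x1 _; rewrite ltrN10.
apply: le_trans (nevanlinna_B_ge x0).
rewrite exprVn addrC lerBrDr ler_pdivlMr ?exprn_gt0//.
have : 0 < b 0 ^+ 2 by rewrite exprn_gt0.
move: x1 xa; nra.
Unshelve. all: by end_near. Qed.

Lemma cvg_nevanlinna_AB_ninfty : (A x * B x)^-1 @[x --> -oo] --> 0.
Proof.
have b0 := jacobi_b_gt0 sol orthoP 0.
apply/cvgr0Pnorm_le => e e0; near=> x.
have B1 : 1 <= B x by near: x; exact: nevanlinna_B_near_ninfty.
have x0 : x < 0 by near: x; apply: nbhs_ninfty_lt; exact: num_real.
(* This threshold makes [- A x >= - x / b 0 ^+ 2 >= 1 / e], while [B x >= 1]. *)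
have xe : x <= - (b 0 ^+ 2 / e) by near: x; apply: nbhs_ninfty_le; exact: num_real.
have HA := nevanlinna_A_le x0.
rewrite normfV normrM (ler0_norm (ltW (nevanlinna_A_lt0 x0))) (gtr0_norm (lt_le_trans ltr01 B1)).
rewrite exprVn ler_pdivlMr ?exprn_gt0// in HA.
rewrite lerNr ler_pdivrMr// in xe.
have A0 := nevanlinna_A_lt0 x0.
rewrite -[leRHS]invrK lef_pV2 ?posrE ?invr_gt0// ?mulr_gt0 ?oppr_gt0//;
  last by apply: lt_le_trans B1.
apply: (@le_trans _ _ (- A x)); last by rewrite ler_peMr// oppr_ge0 ltW.
rewrite -[e^-1]mul1r ler_pdivrMr//.
have bb : 0 < b 0 ^+ 2 by rewrite exprn_gt0.
rewrite -(ler_pM2r bb) mul1r; nra.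
Unshelve. all: by end_near. Qed.

Lemma cvg_C_div_A_ninfty : l x @[x --> -oo] --> stieltjes_alpha mu P.
Proof.
have decr x y : x < y -> y < 0 -> l y < l x.
  move=> xy y0; apply: C_div_A_decreasing => // z /andP[_ zy].
  by rewrite lt_eqF// nevanlinna_A_lt0// (le_lt_trans zy).
have l_le0 x : x < 0 -> l x <= 0.
  move=> x0; apply: mulr_ge0_le0; first exact: le_trans (nevanlinna_C_ge1 x0).
  by rewrite invr_le0 ltW// nevanlinna_A_lt0.
(* As [l] is decreasing and bounded above on the negative axis, its limit at [-oo] is its supremum
   there. *)
pose S := [set l x | x in [set x | x < 0]].
have supS : has_sup S.
  split; first by exists (l (- 1)), (- 1) => //=; rewrite ltrN10.
  by exists 0 => _ [x x0 <-]; exact: l_le0.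
have cl : l x @[x --> -oo] --> sup S.
  apply/cvgrPdist_le => e e0.
  have [_ [x1 /= x10 <-] x1S] := sup_adherent e0 supS.
  near=> x.
  have xx1 : x < x1 by near: x; apply: nbhs_ninfty_lt; exact: num_real.
  have x0 := lt_trans xx1 x10.
  have lxS : l x <= sup S by apply: sup_upper_bound => //; exists x.
  rewrite ger0_norm ?subr_ge0// lerBlDr -lerBlDl.
  by apply: ltW; apply: lt_trans x1S _; exact: decr.
suff -> : stieltjes_alpha mu P = sup S by [].
apply: cvg_lim => //.
have c2 : l x + (A x * B x)^-1 @[x --> -oo] --> sup S.
  by rewrite -[X in _ --> X]addr0; apply: cvgD => //; exact: cvg_nevanlinna_AB_ninfty.
apply: cvg_trans c2; apply: near_eq_cvg; near=> x.
have x0 : x < 0 by near: x; apply: nbhs_ninfty_lt; exact: num_real.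
have Ax0 : A x != 0 by rewrite lt_eqF// nevanlinna_A_lt0.
have Bx0 : B x != 0.
  apply: lt0r_neq0; apply: lt_le_trans ltr01 _.
  by near: x; exact: nevanlinna_B_near_ninfty.
(* Replacing the numerator 1 by [A D - B C] turns [C / A + 1 / (A B)] into [D / B]. *)
rewrite -[(A x * B x)^-1]mul1r -(nevanlinna_det x); field; exact/andP.
Unshelve. all: by end_near. Qed.

End Nevanlinna.

(** * The intervals between the enumerated zeros of [A] *)

Theorem proposition3p2 (R : realType) (s : nat -> R)
    (s_hamburger : normalized_hamburger s)
    (s_indeterminate : indeterminate s)
    (s_stieltjes : stieltjes s)
    (mu : borel_probability R) (mu_sol : moment_solution s mu)
    (P : nat -> {poly R}) (P_orthonormal : orthonormal_polys mu P)
    (alpha : nat -> R)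
    (alpha_incr : {homo alpha : i j / (i < j)%N >-> i < j})
    (alpha_zeros : forall x : R,
      nevanlinna_A mu P x = 0 <-> exists k : nat, x = alpha k) :
  let l := fun x : R => nevanlinna_C mu P x / nevanlinna_A mu P x in
  [/\ {in `]-oo, (alpha 0%N)[ &, {homo l : x y /~ x < y}},
      forall k : nat,
        {in `](alpha k), (alpha k.+1)[ &, {homo l : x y /~ x < y}},
      forall k : nat, l x @[x --> (alpha k)^'-] --> -oo,
      forall k : nat, l x @[x --> (alpha k)^'+] --> +oo &
      l x @[x --> -oo] --> stieltjes_alpha mu P].
Proof.
move=> l.
have alpha_zero k : nevanlinna_A mu P (alpha k) = 0 by apply/alpha_zeros; exists k.
have decr := C_div_A_decreasing mu_sol P_orthonormal s_indeterminate.
have alpha_le : {homo alpha : i j / (i <= j)%N >-> i <= j}.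
  by move=> i j; rewrite leq_eqVlt => /predU1P[->//|/alpha_incr/ltW].
split.
- move=> x y; rewrite !in_itv/= => x0 y0 yx; apply: decr => // z /andP[_ zx].
  apply/eqP => /alpha_zeros[k zE].
  have := lt_le_trans x0 (alpha_le 0%N k (leq0n k)).
  by rewrite -zE ltNge zx.
- move=> k x y; rewrite !in_itv/= => /andP[_ xk] /andP[ky _] yx.
  apply: decr => // z /andP[yz zx]; apply/eqP => /alpha_zeros[j zE].
  (* A zero [alpha j] in [[y, x]] would lie strictly between [alpha k] and [alpha k.+1], against
     monotonicity of [alpha] in either case. *)
  have [jk|kj] := leqP j k.
    by have := lt_le_trans ky yz; rewrite zE ltNge alpha_le.
  by have := le_lt_trans zx xk; rewrite zE ltNge alpha_le.
- by move=> k; exact: (C_div_A_at_left mu_sol P_orthonormal s_indeterminate).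
- by move=> k; exact: (C_div_A_at_right mu_sol P_orthonormal s_indeterminate).
- exact: (cvg_C_div_A_ninfty mu_sol P_orthonormal s_indeterminate s_stieltjes).
Qed.
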